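(* Let $\Gamma$ be a finite simplicial graph such that $\mathrm{Out}(G(\Gamma))$ is finite and $G(\Gamma)\not\cong\mathbb Z$. Then $\mathrm{Aut}(\mathcal P(\Gamma))\cong\mathrm{Isom}(G(\Gamma),d_r)$ as groups, where $\mathrm{Aut}(\mathcal P(\Gamma))$ is the group of simplicial automorphisms of $\mathcal P(\Gamma)$ and $d_r$ is the syllable metric.
   Context: All graphs are simple. For a finite simplicial graph $\Gamma$ with vertex set $\{v_i\}_{i\in I}$, the right-angled Artin group $G(\Gamma)$ is the group with presentation $\langle v_i,\ i\in I \mid [v_i,v_j]=1 \text{ if } v_i, v_j \text{ are joined by an edge}\rangle$. The syllable length of an element $\omega\in G(\Gamma)$ is the minimal $l$ such that $\omega$ can be written as a product of $l$ elements of the form $v_i^{k_i}$ with $v_i$ a standard generator (a vertex of $\Gamma$) and $k_i\in\mathbb Z$. It induces the left-invariant metric $d_r$ on $G(\Gamma)$, $d_r(g,h)$ being the syllable length of $g^{-1}h$. The extension complex $\mathcal P(\Gamma)$ is the flag complex of the extension graph $\Gamma^e$, whose vertices are the elements of $G(\Gamma)$ conjugate to standard generators, two distinct vertices being adjacent if and only if the corresponding elements commute. (Equivalently, vertices of $\mathcal P(\Gamma)$ are the parallel classes of standard geodesics in the universal cover of the Salvetti complex.) *)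

(* Defs.v *)
From HB Require Import structures.
From mathcomp Require Import all_boot ssralg ssrint finmap.
From mathcomp Require Import boolp classical_sets cardinality.

Set Implicit Arguments.
Unset Strict Implicit.
Unset Printing Implicit Defensive.

Local Open Scope quotient_scope.
Local Open Scope group_scope.

Definition isomorphic (G H : groupType) : Prop :=
  exists f : {multiplicative G -> H}, bijective f.

(* [x ^ k] is conjugation in [group_scope]. *)
Definition expgz (G : groupType) (x : G) (k : int) : G :=
  match k with Posz n => x ^+ n | Negz n => x ^- n.+1 end.

(* Classically two elements of [Sym T] with the same underlying function are
   equal (see [SymP]). *)
Record Sym (T : Type) := MkSym {
  sym_fun :> T -> T;
  sym_inv : T -> T;
  sym_funK : cancel sym_fun sym_inv;
  sym_invK : cancel sym_inv sym_fun
}.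

Section SymGroup.
Variable T : Type.
Implicit Types f g : Sym T.

Lemma SymP f g : f =1 g -> f = g.
Proof.
case: f g => [f f' fK f'K] [g g' gK g'K] /= /funext fg.
case: g / fg gK g'K => gK g'K.
have fg' : f' = g' by apply/funext => x; rewrite -{1}(g'K x) fK.
by case: g' / fg' gK g'K => gK g'K; congr MkSym; apply: Prop_irrelevance.
Qed.

HB.instance Definition _ := gen_eqMixin (Sym T).
HB.instance Definition _ := gen_choiceMixin (Sym T).

Definition Sym1 : Sym T := @MkSym T id id (fun=> erefl) (fun=> erefl).
Definition SymV f : Sym T := MkSym (@sym_invK T f) (@sym_funK T f).
Definition SymM f g : Sym T :=
  MkSym (can_comp (@sym_funK T f) (@sym_funK T g))
        (can_comp (@sym_invK T g) (@sym_invK T f)).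

Fact SymMA : associative SymM. Proof. by move=> f g h; apply: SymP. Qed.
Fact Sym1M : left_id Sym1 SymM. Proof. by move=> f; apply: SymP. Qed.
Fact SymM1 : right_id Sym1 SymM. Proof. by move=> f; apply: SymP. Qed.
Fact SymVM : left_inverse Sym1 SymV SymM.
Proof. by move=> f; apply: SymP => x; apply: sym_funK. Qed.
Fact SymMV : right_inverse Sym1 SymV SymM.
Proof. by move=> f; apply: SymP => x; apply: sym_invK. Qed.

HB.instance Definition _ :=
  isGroup.Build (Sym T) SymMA Sym1M SymM1 SymVM SymMV.

End SymGroup.

Section Automorphisms.
Variable G : groupType.

Definition group_aut : {pred Sym G} :=
  fun f => `[< {morph f : x y / x * y} >].

Fact group_aut_closed : group_closed group_aut.
Proof.
split=> [|f g /asboolP fM /asboolP gM]; apply/asboolP => // x y /=.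
rewrite -fM; congr (f _); apply: (can_inj (sym_funK g)).
by rewrite gM !sym_invK.
Qed.

Record Aut := MkAut { aut_sym :> Sym G; autP : group_aut aut_sym }.
HB.instance Definition _ := [isSub for aut_sym].
HB.instance Definition _ := [Choice of Aut by <:].
HB.instance Definition _ :=
  SubChoice_isSubGroup.Build (Sym G) group_aut Aut group_aut_closed.

Definition Inn : {pred Aut} := fun f => `[< exists a : G, f =1 (conjg^~ a) >].

Fact Inn_closed : group_closed Inn.
Proof.
split=> [|f g /asboolP[a fE] /asboolP[b gE]]; apply/asboolP.
  by exists 1 => x; rewrite conjg1.
exists (b^-1 * a) => x; rewrite conjgM -fE.
change (f (sym_inv g x) = f (x ^ b^-1)); congr (aut_sym f _).
by apply: (can_inj (sym_funK g)); rewrite sym_invK gE conjgKV.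
Qed.

Definition Inn_equiv : rel Aut := fun f g => (f^-1 * g) \in Inn.

Fact Inn_equiv_refl : reflexive Inn_equiv.
Proof. by move=> f; rewrite /Inn_equiv mulVg Inn_closed.1. Qed.
Fact Inn_equiv_sym : symmetric Inn_equiv.
Proof.
have VInn f : f \in Inn -> f^-1 \in Inn by apply: group_closedV Inn_closed _.
by move=> f g; apply/idP/idP => /VInn; rewrite invgM invgK.
Qed.
Fact Inn_equiv_trans : transitive Inn_equiv.
Proof.
move=> g f h fg gh; rewrite /Inn_equiv.
have -> : f^-1 * h = (f^-1 * g) * (g^-1 * h) by rewrite mulgA mulgK.
exact: (group_closedM Inn_closed).
Qed.
Canonical Inn_equivRel :=
  EquivRel Inn_equiv Inn_equiv_refl Inn_equiv_sym Inn_equiv_trans.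

(* Only the underlying set of Out(G) = Aut(G) / Inn(G), the set of cosets
   [f Inn(G)], is constructed. *)
Definition Out := {eq_quot Inn_equiv}.

Definition finite_Out : Prop := finite_set [set: Out]%classic.

End Automorphisms.

Section Presentation.
Variables (A : choiceType) (R : seq (A * bool) -> Prop).

(* The letter [(a, true)] stands for the generator [a], and [(a, false)] for
   its inverse. *)
Definition letterV (x : A * bool) : A * bool := (x.1, ~~ x.2).
Definition wordV (w : seq (A * bool)) : seq (A * bool) := rev (map letterV w).

Inductive pres_eq : seq (A * bool) -> seq (A * bool) -> Prop :=
| pres_refl w : pres_eq w w
| pres_sym w1 w2 : pres_eq w1 w2 -> pres_eq w2 w1
| pres_trans w2 w1 w3 : pres_eq w1 w2 -> pres_eq w2 w3 -> pres_eq w1 w3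
| pres_cancel s x t : pres_eq (s ++ x :: letterV x :: t) (s ++ t)
| pres_relator s r t : R r -> pres_eq (s ++ r ++ t) (s ++ t).

Definition pres_eqb : rel (seq (A * bool)) := fun w1 w2 => `[< pres_eq w1 w2 >].

Fact pres_eqb_refl : reflexive pres_eqb.
Proof. by move=> w; apply/asboolP/pres_refl. Qed.
Fact pres_eqb_sym : symmetric pres_eqb.
Proof. by move=> w1 w2; apply/asboolP/asboolP => /pres_sym. Qed.
Fact pres_eqb_trans : transitive pres_eqb.
Proof.
by move=> w2 w1 w3 /asboolP e12 /asboolP e23; apply/asboolP/(pres_trans e12).
Qed.
Canonical pres_equivRel :=
  EquivRel pres_eqb pres_eqb_refl pres_eqb_sym pres_eqb_trans.

Definition presented := {eq_quot pres_eqb}.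
HB.instance Definition _ := Choice.on presented.

Definition pres_class (w : seq (A * bool)) : presented :=
  \pi_{eq_quot pres_eqb} w.
Definition pres_word (x : presented) : seq (A * bool) := repr x.

Lemma pres_wordK : cancel pres_word pres_class.
Proof. exact: reprK. Qed.

Lemma pres_classP w1 w2 : pres_class w1 = pres_class w2 <-> pres_eq w1 w2.
Proof. by split => [/eqmodP/asboolP | e]; last apply/eqmodP/asboolP. Qed.

Lemma presW (P : presented -> Prop) :
  (forall w, P (pres_class w)) -> forall x, P x.
Proof. by move=> Pw x; rewrite -[x]pres_wordK. Qed.

Fact letterVK : involutive letterV.
Proof. by case=> a b; rewrite /letterV negbK. Qed.

Fact wordVK : involutive wordV.
Proof.
by move=> w; rewrite /wordV map_rev revK -map_comp map_id_in // => x _;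
  apply: letterVK.
Qed.

Fact pres_eq_catl s w1 w2 : pres_eq w1 w2 -> pres_eq (s ++ w1) (s ++ w2).
Proof.
elim=> {w1 w2} [w|w1 w2 _|w2 w1 w3 _ e12 _|u x t|u r t Rr].
- exact: pres_refl.
- exact: pres_sym.
- exact: pres_trans.
- by rewrite !catA; apply: pres_cancel.
- by rewrite (catA s u t) (catA s u (r ++ t)); apply: pres_relator.
Qed.

Fact pres_eq_catr s w1 w2 : pres_eq w1 w2 -> pres_eq (w1 ++ s) (w2 ++ s).
Proof.
elim=> {w1 w2} [w|w1 w2 _|w2 w1 w3 _ e12 _|u x t|u r t Rr].
- exact: pres_refl.
- exact: pres_sym.
- exact: pres_trans.
- by rewrite -!catA; apply: pres_cancel.
- by rewrite -!catA; apply: pres_relator.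
Qed.

Fact pres_eq_cat w1 w2 s1 s2 :
  pres_eq w1 w2 -> pres_eq s1 s2 -> pres_eq (w1 ++ s1) (w2 ++ s2).
Proof.
by move=> e1 e2; apply: (pres_trans (pres_eq_catr s1 e1)); apply: pres_eq_catl.
Qed.

Fact pres_eq_Vw w : pres_eq (wordV w ++ w) [::].
Proof.
elim: w => [|x w IHw]; first exact: pres_refl.
rewrite /wordV /= rev_cons cat_rcons; apply: pres_trans IHw.
by rewrite -{2}[x]letterVK; apply: pres_cancel.
Qed.

Fact pres_eq_wV w : pres_eq (w ++ wordV w) [::].
Proof. by rewrite -{1}[w]wordVK; apply: pres_eq_Vw. Qed.

Fact pres_eq_V w1 w2 : pres_eq w1 w2 -> pres_eq (wordV w1) (wordV w2).
Proof.
move=> e12; have := pres_eq_catl (wordV w1) (pres_eq_wV w2).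
rewrite cats0 => /pres_sym e; apply: (pres_trans e).
rewrite catA -[X in pres_eq _ X]cat0s; apply: pres_eq_catr.
apply: pres_trans (pres_eq_Vw w1); apply: pres_eq_catl.
exact: pres_sym.
Qed.

Definition pres_one : presented := pres_class [::].
Definition pres_inv (x : presented) := pres_class (wordV (pres_word x)).
Definition pres_mul (x y : presented) :=
  pres_class (pres_word x ++ pres_word y).

Lemma pres_classV w : pres_inv (pres_class w) = pres_class (wordV w).
Proof. by apply/pres_classP/pres_eq_V/pres_classP/pres_wordK. Qed.

Lemma pres_classM w1 w2 :
  pres_mul (pres_class w1) (pres_class w2) = pres_class (w1 ++ w2).
Proof.
by apply/pres_classP/pres_eq_cat; apply/pres_classP/pres_wordK.
Qed.

Fact presMA : associative pres_mul.
Proof.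
elim/presW=> x; elim/presW=> y; elim/presW=> z.
by rewrite !pres_classM catA.
Qed.
Fact pres1M : left_id pres_one pres_mul.
Proof. by elim/presW=> x; rewrite pres_classM. Qed.
Fact presM1 : right_id pres_one pres_mul.
Proof. by elim/presW=> x; rewrite pres_classM cats0. Qed.
Fact presVM : left_inverse pres_one pres_inv pres_mul.
Proof.
elim/presW=> x; rewrite pres_classV pres_classM.
exact/pres_classP/pres_eq_Vw.
Qed.
Fact presMV : right_inverse pres_one pres_inv pres_mul.
Proof.
elim/presW=> x; rewrite pres_classV pres_classM.
exact/pres_classP/pres_eq_wV.
Qed.

HB.instance Definition _ :=
  isGroup.Build presented presMA pres1M presM1 presVM presMV.

Definition pres_gen (a : A) : presented := pres_class [:: (a, true)].

End Presentation.

Record sgraph (V : choiceType) := SGraph {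
  adj :> rel V;
  adj_sym : symmetric adj;
  adj_irr : irreflexive adj
}.

Section SimplicialComplex.
Local Open Scope fset_scope.

(* Simplices are nonempty, and every element of [V] is a vertex. *)
Record simplicial_complex (V : choiceType) := SimplicialComplex {
  simplex :> {fset V} -> Prop;
  simplex_neq0 : forall s, simplex s -> s != fset0;
  simplex1 : forall v, simplex [fset v];
  simplexS : forall s t, s != fset0 -> s `<=` t -> simplex t -> simplex s
}.

Section Flag.
Variables (V : choiceType) (E : sgraph V).

Definition flag_simplex (s : {fset V}) : Prop :=
  s != fset0 /\ {in s &, forall x y, x != y -> E x y}.

Fact flag_simplex_neq0 s : flag_simplex s -> s != fset0.
Proof. by case. Qed.
Fact flag_simplex1 v : flag_simplex [fset v].
Proof.
split; first by apply/fset0Pn; exists v; rewrite fset11.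
by move=> x y /fset1P-> /fset1P->; rewrite eqxx.
Qed.
Fact flag_simplexS s t :
  s != fset0 -> s `<=` t -> flag_simplex t -> flag_simplex s.
Proof.
by move=> s0 /fsubsetP st [_ tE]; split=> // x y /st xt /st yt; apply: tE.
Qed.

Definition flag_complex : simplicial_complex V :=
  SimplicialComplex flag_simplex_neq0 flag_simplex1 flag_simplexS.

End Flag.

Variables (V : choiceType) (K : simplicial_complex V).

Definition simplicial_aut : {pred Sym V} :=
  fun f => `[< forall s : {fset V}, K (f @` s) <-> K s >].

Fact simplicial_aut_closed : group_closed simplicial_aut.
Proof.
split=> [|f g /asboolP fK /asboolP gK]; apply/asboolP => s.
  by rewrite imfset_id.
have e1 : (f / g) @` s = f @` (SymV g @` s) by rewrite -imfset_comp.
have e2 : g @` (SymV g @` s) = s.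
  rewrite -imfset_comp -[RHS]imfset_id.
  by apply: eq_imfset => // x; apply: sym_invK.
by rewrite e1; apply: (iff_trans (fK _)); rewrite -(gK _) e2.
Qed.

Record AutC := MkAutC { autC_sym :> Sym V; autCP : simplicial_aut autC_sym }.
HB.instance Definition _ := [isSub for autC_sym].
HB.instance Definition _ := [Choice of AutC by <:].
HB.instance Definition _ :=
  SubChoice_isSubGroup.Build (Sym V) simplicial_aut AutC simplicial_aut_closed.

End SimplicialComplex.

Section Isometries.
Variables (T : Type) (d : T -> T -> nat).

Definition isometric : {pred Sym T} :=
  fun f => `[< forall x y, d (f x) (f y) = d x y >].

Fact isometric_closed : group_closed isometric.
Proof.
split=> [|f g /asboolP fd /asboolP gd]; apply/asboolP => // x y /=.
by rewrite fd -gd !sym_invK.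
Qed.

Record Isom := MkIsom { isom_sym :> Sym T; isomP : isometric isom_sym }.
HB.instance Definition _ := [isSub for isom_sym].
HB.instance Definition _ := [Choice of Isom by <:].
HB.instance Definition _ :=
  SubChoice_isSubGroup.Build (Sym T) isometric Isom isometric_closed.

End Isometries.

Section RAAG.
Variables (V : finType) (E : sgraph V).

(* The word of the commutator [v^-1 w^-1 v w]. *)
Definition raag_relator (r : seq (V * bool)) : Prop :=
  exists v w : V,
    E v w /\ r = [:: (v, false); (w, false); (v, true); (w, true)].

Definition raag := presented raag_relator.
HB.instance Definition _ := Group.on raag.

Definition raag_gen (v : V) : raag := pres_gen raag_relator v.

Definition syllable_prod (s : seq (V * int)) : raag :=
  \prod_(p <- s) expgz (raag_gen p.1) p.2.

Definition has_syllables (g : raag) (l : nat) : bool :=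
  `[< exists2 s : seq (V * int), size s = l & g = syllable_prod s >].

Fact has_syllables_ex (g : raag) : exists l, has_syllables g l.
Proof.
suff [s ->] : exists s, g = syllable_prod s.
  by exists (size s); apply/asboolP; exists s.
elim/presW: g => w; elim: w => [|[v b] w [s IHs]].
  by exists [::]; rewrite /syllable_prod big_nil.
exists ((v, if b then Posz 1 else Negz 0) :: s).
rewrite /syllable_prod big_cons -/(syllable_prod s) -IHs /=.
case: b; rewrite /= expg1; apply: esym; first exact: pres_classM.
have -> : (raag_gen v)^-1 = pres_class raag_relator [:: (v, false)].
  exact: pres_classV.
exact: pres_classM.
Qed.

Definition syllable_length (g : raag) : nat := ex_minn (has_syllables_ex g).

Definition syllable_dist (g h : raag) : nat := syllable_length (g^-1 * h).

Definition ext_vertex_pred : {pred raag} :=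
  fun g => `[< exists (v : V) (h : raag), g = raag_gen v ^ h >].

Record ext_vertex :=
  ExtVertex { ext_val :> raag; ext_valP : ext_vertex_pred ext_val }.
HB.instance Definition _ := [isSub for ext_val].
HB.instance Definition _ := [Choice of ext_vertex by <:].

Definition ext_adj : rel ext_vertex :=
  fun x y => (x != y) && (ext_val x * ext_val y == ext_val y * ext_val x).

Fact ext_adj_sym : symmetric ext_adj.
Proof. by move=> x y; congr (~~ _ && _); apply: eq_sym. Qed.
Fact ext_adj_irr : irreflexive ext_adj.
Proof. by move=> x; rewrite /ext_adj eqxx. Qed.

Definition extension_graph : sgraph ext_vertex :=
  SGraph ext_adj_sym ext_adj_irr.

Definition extension_complex : simplicial_complex ext_vertex :=
  flag_complex extension_graph.

End RAAG.

(* Main.v *)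
From HB Require Import structures.
From mathcomp Require Import all_boot perm ssralg ssrint finmap.
From mathcomp Require Import boolp classical_sets cardinality zify.
Require Import Defs.

Set Implicit Arguments.
Unset Strict Implicit.
Unset Printing Implicit Defensive.

Local Open Scope group_scope.

(** Write G for the right-angled Artin group and call the vertices of the
    extension graph walls.  The assignment [a |-> delta_a] on generators extends
    to a crossed homomorphism [cross] from G to Z[G]; the wall [v] separates [p]
    from [q] if [cross v p <> cross v q], and the syllable distance of [p] and
    [q] is the number of walls separating them.  So a point is determined by its
    coordinates [cross v p], and it lies on finitely many walls, the conjugates
    by [p] of the generators.

    If Out(G) is finite, then powers of transvections and of partial conjugations
    show that no link is contained in the star of another vertex and that no star
    separates.  It follows that the level sets of [cross v] are the connected
    components of the extension graph minus the star of [v].  The coordinates,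
    hence the syllable distance, are thus intrinsic to the extension graph, and
    an automorphism transports the coordinates of a point to a consistent family
    of coordinates differing from those of any given point at finitely many walls;
    such a family is the family of coordinates of a point.  Conversely an isometry
    maps parallel edges to parallel edges, which gives a map on walls, and two
    distinct walls commute exactly when they cut G into four nonempty quadrants. *)

(** * Homomorphisms out of a right-angled Artin group *)

Section IntegerPowers.
Variable G : groupType.
Implicit Types (x y : G) (j k : int).

Lemma expgzS x k : expgz x (k + 1)%R = expgz x k * x.
Proof.
case: k => [n|[|n]]; first by rewrite -PoszD addn1 /= expgSr.
  by rewrite /= expg1 mulVg.
have -> : (Negz n.+1 + 1)%R = Negz n by lia.
by rewrite /= [x ^+ n.+2]expgS invgM mulgVK.
Qed.

Lemma expgz_pred x k : expgz x (k - 1)%R = expgz x k * x^-1.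
Proof. by apply: (mulIg x); rewrite -expgzS GRing.subrK mulgVK. Qed.

Lemma expgzD x j k : expgz x (j + k)%R = expgz x j * expgz x k.
Proof.
elim/int_rec: k => [|n IH|n IH]; first by rewrite GRing.addr0 mulg1.
  by rewrite -addn1 PoszD GRing.addrA !expgzS IH mulgA.
by rewrite -addn1 PoszD GRing.opprD GRing.addrA !expgz_pred IH mulgA.
Qed.

Lemma commute_expgz x y k : commute x y -> commute x (expgz y k).
Proof.
by case: k => n xy; [apply: commuteX | apply: commuteV; apply: commuteX].
Qed.

Lemma commuteJ x y z : commute x y -> commute (x ^ z) (y ^ z).
Proof. by rewrite /commute -!conjMg => ->. Qed.

Lemma commute_conjg x y : commute x y <-> x ^ y = x.
Proof.
split=> [xy|e]; first by rewrite conjgE xy mulKg.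
by rewrite /commute conjgC e.
Qed.

End IntegerPowers.

Lemma gmulf_expgz (G H : groupType) (f : UMagmaMorphism.type G H) x k :
  f (expgz x k) = expgz (f x) k.
Proof.
by case: k => n; [apply: gmulfXn | apply: gmulfXVn].
Qed.

Section Lift.
Variables (V : finType) (E : sgraph V).
Local Notation G := (raag E).
Local Notation gen := (raag_gen E).

Definition letter (x : V * bool) : G := pres_class (raag_relator E) [:: x].

Lemma letterE x : letter x = if x.2 then gen x.1 else (gen x.1)^-1.
Proof. by case: x => a [] //=; apply: esym; exact: pres_classV. Qed.

Lemma letter_letterV x : letter (letterV x) = (letter x)^-1.
Proof. by rewrite !letterE; case: x => a [] //=; rewrite invgK. Qed.

Lemma pres_class_cons x w :
  pres_class (raag_relator E) (x :: w) = letter x * pres_class _ w :> G.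
Proof. by apply: esym; apply: pres_classM. Qed.

Lemma pres_class_relator a b : E a b ->
  pres_class (raag_relator E)
    [:: (a, false); (b, false); (a, true); (b, true)] = 1 :> G.
Proof.
move=> ab; apply/pres_classP; rewrite -[X in pres_eq _ X]cats0.
by rewrite -[X in pres_eq _ X]cat0s; apply: pres_relator; exists a, b.
Qed.

Lemma gen_commute a b : E a b -> commute (gen a) (gen b).
Proof.
move=> ab; apply/commgP/eqP; rewrite -(pres_class_relator ab).
rewrite !pres_class_cons !letterE commgEl conjgE /=.
by rewrite [pres_class _ [::]](_ : _ = 1) // mulg1.
Qed.

Lemma raag_ind (P : G -> Prop) :
    P 1 -> (forall a k g, P g -> P (expgz (gen a) k * g)) ->
  forall g, P g.
Proof.
move=> P1 PM g; have [l /asboolP[s _ ->]] := has_syllables_ex g.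
elim: s => [|[a k] s IHs]; first by rewrite /syllable_prod big_nil.
by rewrite /syllable_prod big_cons; apply: PM.
Qed.

(** Universal property: evaluating words in [H] respects cancellations and commutators, so [F] may
    evaluate the representative [pres_word]. *)
Lemma raag_lift (H : groupType) (f : V -> H) :
    (forall a b, E a b -> commute (f a) (f b)) ->
  exists F : UMagmaMorphism.type G H, forall a, F (gen a) = f a.
Proof.
move=> fC; pose L (w : seq (V * bool)) : H :=
  \prod_(x <- w) (if x.2 then f x.1 else (f x.1)^-1).
have Lcat s t : L (s ++ t) = L s * L t by rewrite /L big_cat.
have L1 x : L [:: x] = if x.2 then f x.1 else (f x.1)^-1 by rewrite /L big_seq1.
have Lc x t : L (x :: t) = L [:: x] * L t by rewrite -cat1s Lcat.
have Leq w1 w2 : pres_eq (raag_relator E) w1 w2 -> L w1 = L w2.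
  elim=> {w1 w2} [//|//|w2 w1 w3 _ -> _ -> //|s x t|s r t [a [b [ab ->]]]].
    rewrite !Lcat Lc [L (letterV x :: t)]Lc; congr (_ * _); rewrite mulgA.
    by rewrite !L1 /=; case: x.2 => /=; rewrite ?mulgV ?mulVg mul1g.
  rewrite !Lcat; congr (_ * _); rewrite -[RHS]mul1g; congr (_ * _).
  rewrite /L !big_cons big_nil mulg1 /=; apply/eqP/commgP; exact: fC.
pose F (x : G) : H := L (pres_word x).
have FM : {morph F : x y / x * y}.
  by move=> x y; rewrite /F -Lcat; apply/Leq/pres_classP; rewrite pres_wordK.
have Fgen a : F (gen a) = f a.
  have -> : f a = L [:: (a, true)] by rewrite L1.
  by apply/Leq/pres_classP; rewrite pres_wordK.
have F1 : F 1 = 1 by apply: (mulgI (F 1)); rewrite -FM !mulg1.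
pose Fm := isUMagmaMorphism.Build G H F (F1, FM).
by exists (HB.pack_for (UMagmaMorphism.type G H) F Fm).
Qed.

Lemma raag_hom_ext (H : groupType) (F1 F2 : UMagmaMorphism.type G H) :
  (forall a, F1 (gen a) = F2 (gen a)) -> F1 =1 F2.
Proof.
move=> e; elim/raag_ind => [|a k g IHg]; first by rewrite !gmulf1.
by rewrite !gmulfM !gmulf_expgz e IHg.
Qed.

End Lift.

(** * Walls and the syllable metric *)

Section Crossing.
Variables (V : finType) (E : sgraph V).
Local Notation G := (raag E).
Local Notation gen := (raag_gen E).
Local Notation dist := (@syllable_dist V E).
Local Notation len := (@syllable_length V E).
Local Notation sprod := (@syllable_prod V E).
Implicit Types (u v p q g : G) (a b : V).

(** Reading [x] moves the base point, from which the wall [v] is then seen as [v ^ x]. A generator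
    and its inverse leave the base point along the same wall, with opposite signs. *)
Fixpoint cross_word v (w : seq (V * bool)) : int :=
  if w is x :: w' then
    ((if v == gen x.1 then if x.2 then 1 else -1 else 0)
     + cross_word (v ^ letter E x)%g w')%R
  else 0%R.

Lemma cross_word_cat v s t :
  cross_word v (s ++ t)
  = (cross_word v s + cross_word (v ^ (pres_class (raag_relator E) s : G))%g t)%R.
Proof.
elim: s v => [|x s IHs] v; first 
  by rewrite [pres_class _ _](_ : _ = 1) // conjg1 GRing.add0r.
by rewrite /= IHs GRing.addrA pres_class_cons conjgM.
Qed.

Lemma conjg_eq_gen v a p : commute (gen a) p -> (v ^ p == gen a) = (v == gen a).
Proof.
move=> /commute_conjg e; rewrite -{1}e; exact: (inj_eq (@conjg_inj G p)).
Qed.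

Lemma commute_letter a x : (x.1 == a) || E a x.1 -> commute (gen a) (letter E x).
Proof.
rewrite letterE => ax; have ca : commute (gen a) (gen x.1).
  by case/orP: ax => [/eqP-> //|/gen_commute].
by case: x.2 => //; apply: commuteV.
Qed.

Lemma cross_word_eq v w1 w2 :
  pres_eq (raag_relator E) w1 w2 -> cross_word v w1 = cross_word v w2.
Proof.
move=> e; elim: e v => {w1 w2} [//|w1 w2 _ IH v|w2 w1 w3 _ IH1 _ IH2 v|s x t v|].
- by rewrite IH.
- by rewrite IH1.
- rewrite !cross_word_cat; congr (_ + _)%R; move: (v ^ _) => {}v /=.
  rewrite conjg_eq_gen; last by apply: commute_letter; rewrite eqxx.
  rewrite letter_letterV conjgK GRing.addrA.
  by case: eqP; case: x.2 => _; rewrite GRing.add0r.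
move=> s r t [a [b [ab ->]]] v; rewrite !cross_word_cat; congr (_ + _)%R.
move: (v ^ _) => {}v /=; have ba := ab; rewrite adj_sym in ba.
have cab := gen_commute ab; have cba := gen_commute ba.
rewrite !letterE /= -!conjgM conjg_eq_gen; last exact: commuteV.
rewrite conjg_eq_gen; last by apply: commuteM; apply: commuteV.
rewrite conjg_eq_gen; last by do 2?apply: commuteM => //; apply: commuteV.
rewrite (pres_class_relator ab).
by rewrite conjg1; do 2!case: eqP => _; lia.
Qed.

(* The crossed homomorphism [raag -> Z^raag] determined by
   [gen a |-> delta_(gen a)]: [cross v p] counts with sign the edges
   [g -- g * gen a] with [g a g^-1 = v] on any path from [1] to [p], i.e. it is
   the position of [p] relative to the wall [v]. *)
Definition cross v p : int := cross_word v (pres_word p).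

Lemma crossM v p q : cross v (p * q) = (cross v p + cross (v ^ p)%g q)%R.
Proof.
rewrite /cross -[in (v ^ p)%g](pres_wordK p) -cross_word_cat; apply: cross_word_eq.
by apply/pres_classP; rewrite pres_wordK.
Qed.

Lemma cross1 v : cross v 1 = 0%R.
Proof. by have := crossM v 1 1; rewrite mulg1 conjg1; lia. Qed.

Lemma cross_gen v a : cross v (gen a) = (if v == gen a then 1 else 0)%R.
Proof.
transitivity (cross_word v [:: (a, true)]); last by rewrite /= GRing.addr0.
by apply: cross_word_eq; apply/pres_classP; rewrite pres_wordK.
Qed.

Lemma cross_expgz v a k :
  cross v (expgz (gen a) k) = (if v == gen a then k else 0)%R.
Proof.
have c j : commute (gen a) (expgz (gen a) j) by apply: commute_expgz.
elim/int_rec: k => [|n IH|n IH]; first by rewrite cross1 if_same.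
  by rewrite -addn1 PoszD expgzS crossM IH cross_gen conjg_eq_gen //; case: eqP; lia.
have := crossM v (expgz (gen a) (- n.+1%:Z)%R) (gen a).
rewrite -expgzS cross_gen conjg_eq_gen //.
have -> : (- n.+1%:Z + 1 = - n%:Z)%R by lia.
by rewrite IH; case: eqP => _; lia.
Qed.

Lemma crossM_expgz v p a k :
  cross v (p * expgz (gen a) k)
  = (cross v p + if (v ^ p)%g == gen a then k else 0)%R.
Proof. by rewrite crossM cross_expgz. Qed.

(** The exponent sum of [b] has values in an abelian group, so conjugation preserves it. *)
Lemma gen_conj_inj a b g : gen a ^ g = gen b -> a = b.
Proof.
pose Z := Algebra.to_multiplicative int.
pose f x : Z := Posz (x == b).
have [|F Ff] := @raag_lift V E Z f.
  by move=> x y _; apply: GRing.addrC.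
move=> /(congr1 F); rewrite gmulfJ !Ff.
have -> : f a ^ F g = f a.
  by apply/commute_conjg; apply: GRing.addrC.
by rewrite /f eqxx; case: eqP.
Qed.

Lemma sprod_cat s t : sprod (s ++ t) = sprod s * sprod t.
Proof. exact: big_cat. Qed.

Lemma sprod_cons a k s : sprod ((a, k) :: s) = expgz (gen a) k * sprod s.
Proof. exact: big_cons. Qed.

Lemma syllable_length_ex g : exists2 s, size s = len g & g = sprod s.
Proof. by rewrite /len; case: ex_minnP => l /asboolP. Qed.

Lemma syllable_length_min s : len (sprod s) <= size s.
Proof.
rewrite /len; case: ex_minnP => l _; apply; apply/asboolP.
by exists s.
Qed.

Lemma syllable_crossing v s : cross v (sprod s) != 0%R ->
  exists s1 a k s2, [/\ s = s1 ++ (a, k) :: s2, v ^ sprod s1 = gen a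
                      & cross v (sprod s1) = 0%R].
Proof.
elim: s v => [|[a k] s IHs] v; first by rewrite /syllable_prod big_nil cross1.
case: (v =P gen a) => [va _|va].
  by exists [::], a, k, s; rewrite /syllable_prod big_nil conjg1 cross1.
rewrite sprod_cons crossM cross_expgz (introF eqP va) GRing.add0r.
move=> /IHs[s1 [b [j [s2 [-> v1 c1]]]]].
exists ((a, k) :: s1), b, j, s2; rewrite sprod_cons conjgM v1; split=> //.
by rewrite crossM c1 cross_expgz (introF eqP va).
Qed.

(** Induction along a shortest expression [a^k t] of [g]: the walls between [1] and [g] are [gen a]
    and translates of those between [1] and [sprod t]. *)
Lemma cross_seq g :
  exists s : seq G, [/\ uniq s, forall v, (v \in s) = (cross v g != 0%R)
                      & size s = len g].
Proof.
have [n ltn] := ubnP (len g); elim: n g ltn => // n IHn g ltn.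
have [[|[a k] t] szt gE] := syllable_length_ex g.
  exists [::]; split=> // v.
  by rewrite gE /syllable_prod big_nil cross1 eqxx.
rewrite sprod_cons in gE.
have lt : len (sprod t) = size t.
  apply/eqP; rewrite eqn_leq syllable_length_min /= -ltnS.
  have [t' szt' tE] := syllable_length_ex (sprod t).
  have -> : (size t).+1 = len g by [].
  by rewrite gE -szt' tE -sprod_cons; apply: (syllable_length_min ((a, k) :: t')).
have k0 : k != 0%R.
  apply/eqP => k0; have := syllable_length_min t.
  by rewrite -[sprod t]mul1g -[1](_ : expgz (gen a) 0 = _) // -k0 -gE -szt /= ltnn.
have ca : cross (gen a) (sprod t) = 0%R.
  (* A syllable of [t] crossing [gen a] is again a power of [a], and the prefix [s1] before it
     commutes with [a]; merging the two powers would shorten the expression. *)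
  apply/eqP; apply: contraT => /syllable_crossing[s1 [b [j [s2 [tE a1 _]]]]].
  have ab := gen_conj_inj a1; rewrite -ab in a1 tE.
  have := syllable_length_min (s1 ++ (a, (k + j)%R) :: s2).
  have -> : sprod (s1 ++ (a, (k + j)%R) :: s2) = g.
    rewrite gE tE !sprod_cat !sprod_cons expgzD !mulgA.
    congr (_ * _ * _); apply: commute_sym; apply: commute_sym.
    by apply: commute_expgz; apply: commute_sym; apply/commute_conjg.
  by rewrite -szt /= tE !size_cat /= ltnn.
have [|s' [us' ms' szs']] := IHn (sprod t).
  by rewrite lt; rewrite -szt in ltn.
exists (gen a :: [seq v ^ (expgz (gen a) k)^-1 | v <- s']).
have fixa : gen a ^ expgz (gen a) k = gen a.
  by apply/commute_conjg; apply: commute_expgz.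
have mE v : (v \in [seq x ^ (expgz (gen a) k)^-1 | x <- s'])
            = (v ^ expgz (gen a) k \in s').
  rewrite -[v in LHS](conjgK (expgz (gen a) k)).
  exact: (mem_map (@conjg_inj G _)).
split=> /=.
- rewrite mE fixa ms' ca eqxx map_inj_uniq //; exact: conjg_inj.
- move=> v; rewrite inE mE ms' gE crossM cross_expgz.
  by case: eqP => [->|_]; rewrite ?GRing.add0r // fixa ca GRing.addr0 k0.
- by rewrite size_map szs' lt -szt.
Qed.

Lemma cross_neq v p q :
  (cross v p != cross v q) = (cross (v ^ p) (p^-1 * q) != 0%R).
Proof.
have := crossM v p (p^-1 * q); rewrite mulVKg => ->.
by congr (~~ _); apply/eqP/eqP; lia.
Qed.

Lemma dist_seq p q :
  exists s : seq G, [/\ uniq s, forall v, (v \in s) = (cross v p != cross v q)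
                      & size s = dist p q].
Proof.
have [s [us ms szs]] := cross_seq (p^-1 * q).
exists [seq v ^ p^-1 | v <- s]; split.
- by rewrite map_inj_uniq //; apply: conjg_inj.
- move=> v; rewrite -[v in LHS](conjgK p) (mem_map (@conjg_inj G _)) ms.
  by rewrite cross_neq.
- by rewrite size_map.
Qed.

Lemma dist_uniq p q (s : seq G) :
  uniq s -> (forall v, (v \in s) = (cross v p != cross v q)) ->
  dist p q = size s.
Proof.
move=> us ms; have [t [ut mt <-]] := dist_seq p q.
by apply/perm_size/uniq_perm => // v; rewrite ms mt.
Qed.

Lemma dist0 p q : dist p q = 0 -> p = q.
Proof.
move=> d0; have [s szs e] := syllable_length_ex (p^-1 * q).
rewrite /dist in d0; rewrite d0 in szs; case: s szs e => // _ e.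
by apply/esym; rewrite -[q](mulVKg p) e /syllable_prod big_nil mulg1.
Qed.

Lemma distC p q : dist p q = dist q p.
Proof.
have [s [us ms <-]] := dist_seq p q; apply/esym/dist_uniq => // v.
by rewrite ms eq_sym.
Qed.

Definition between p q r := dist p r = dist p q + dist q r.

Lemma leq_dist_add p q r : dist p r <= dist p q + dist q r.
Proof.
have [s [us ms <-]] := dist_seq p r.
have [s1 [_ ms1 <-]] := dist_seq p q; have [s2 [_ ms2 <-]] := dist_seq q r.
rewrite -size_cat; apply: uniq_leq_size => // v.
by rewrite mem_cat ms ms1 ms2; case: (cross v p =P cross v q) => // ->.
Qed.

(** When the distances add up, counting shows that no wall separates both [p] from [q] and [q] from
    [r]: a geodesic crosses no wall twice. *)
Lemma between_cross p q r v :
  between p q r -> cross v p = cross v q \/ cross v q = cross v r.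
Proof.
rewrite /between; have [s [us ms <-]] := dist_seq p r.
have [s1 [u1 ms1 <-]] := dist_seq p q; have [s2 [u2 ms2 <-]] := dist_seq q r.
rewrite -size_cat => sz; have sub : {subset s <= s1 ++ s2}.
  by move=> x; rewrite mem_cat ms ms1 ms2; case: (cross x p =P cross x q) => // ->.
have us12 : uniq (s1 ++ s2).
  by apply: leq_size_uniq us sub _; rewrite sz.
case: (cross v p =P cross v q) => [|/eqP n1]; first by left.
right; apply/eqP; rewrite -[_ == _]negbK -ms2.
move: us12; rewrite cat_uniq => /and3P[_ /hasPn h _].
by apply/negP => /h; rewrite ms1 n1.
Qed.

(* [p] lies on a standard geodesic in the parallel class [v]. *)
Definition carrier v p : Prop := exists a, v ^ p = gen a.

(** A shortest expression of [p^-1 * q] is cut just before its first syllable on the wall [v]. *)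
Lemma cross_between v p q : cross v p != cross v q ->
  exists x, [/\ carrier v x, cross v x = cross v p & between p x q].
Proof.
move=> pq; have [s szs sE] := syllable_length_ex (p^-1 * q).
have qE : q = p * sprod s by rewrite -sE mulVKg.
have /syllable_crossing[s1 [a [k [s2 [s12 va c0]]]]] :
    cross (v ^ p) (sprod s) != 0%R.
  by move: pq; rewrite qE crossM; lia.
exists (p * sprod s1); split.
- by exists a; rewrite conjgM.
- by rewrite crossM c0 GRing.addr0.
apply/eqP; rewrite eqn_leq leq_dist_add /= {3}/dist -szs s12 size_cat.
apply: leq_add; rewrite /dist; first by rewrite mulKg syllable_length_min.
by rewrite invgM qE s12 sprod_cat -mulgA !mulKg syllable_length_min.
Qed.

End Crossing.

(** * Carriers of walls *)

Definition cycle3 : {perm 'I_3} := perm (can_inj (@ordSK 3)).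
Definition swap01 : {perm 'I_3} := tperm (inord 0) (inord 1).

Lemma commute_cycle3_even (t : {perm 'I_3}) : commute cycle3 t -> ~~ odd_perm t.
Proof.
move=> ct; have c3 : odd_perm cycle3 = false.
  have : cycle3 ^+ 3 = 1.
    apply/permP => i; rewrite !permM perm1 !permE; apply/val_inj.
    by case: i => [[|[|[|]]]].
  by move=> /(congr1 (@odd_perm _)); rewrite !odd_permM odd_perm1; case: odd_perm.
have tE i : t (cycle3 i) = cycle3 (t i) by rewrite -!permM ct.
have powE n : cycle3 ^+ n * t = t * cycle3 ^+ n.
  by apply/esym; apply: commuteX; apply: commute_sym.
have iE (i : 'I_3) : i = (cycle3 ^+ i) ord0.
  by apply/val_inj; case: i => [[|[|[|]]]] //= lt; rewrite ?permM ?perm1 ?permE.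
(* [t] is determined by its value at [ord0], hence is a power of the 3-cycle, and such powers are
   even. *)
have -> : t = cycle3 ^+ (t ord0).
  apply/permP => i; rewrite [in LHS](iE i) -permM powE permM [t ord0 in LHS]iE -permM.
  by rewrite -expgnDr addnC expgnDr permM -iE.
elim: (nat_of_ord _) => [|n IHn]; first by rewrite odd_perm1.
by rewrite expgS odd_permM c3.
Qed.

Lemma not_commute_cycle3_swap01 (h : {perm 'I_3}) : ~ commute cycle3 (swap01 ^ h).
Proof.
move=> /commute_cycle3_even; rewrite odd_permJ odd_tperm.
by rewrite -val_eqE /= !inordK.
Qed.

Section Carriers.
Variables (V : finType) (E : sgraph V).
Local Notation G := (raag E).
Local Notation gen := (raag_gen E).
Local Notation dist := (@syllable_dist V E).
Implicit Types (u v w p q g : G) (a b c : V).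

Lemma gen_commute_conj a c g h :
  commute (gen a ^ g) (gen c ^ h) -> a = c \/ E a c.
Proof.
move=> /(commuteJ (g^-1)); rewrite conjgK -conjgM; move: (h / g) => {}h.
case: (a =P c) => [|/eqP ac] ch; [by left | right].
apply: contraT => /negPf nac.
(* This respects all commutations because no edge joins the two generators with nontrivial image. *)
pose f x : {perm 'I_3} := if x == a then cycle3 else if x == c then swap01 else 1.
have [|F Ff] := @raag_lift V E _ f.
  move=> x y xy; rewrite /f; case: (x =P a) xy => [->|_].
    case: (y =P a) => [-> _|_]; first exact: commute_refl.
    by case: (y =P c) => [->|_ _]; [rewrite nac | apply: commute1].
  case: (x =P c) => [->|_ _]; last by apply: commute_sym; apply: commute1.
  case: (y =P a) => [->|_ _]; first by rewrite adj_sym nac.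
  by case: eqP => _; [apply: commute_refl | apply: commute1].
move: (gmulf_commute F ch); rewrite gmulfJ !Ff /f eqxx eq_sym (negPf ac) eqxx.
by move=> /not_commute_cycle3_swap01.
Qed.

Lemma gen_commuteP a c : commute (gen a) (gen c) <-> a = c \/ E a c.
Proof.
split=> [ac|[->//|/gen_commute//]]; apply: (@gen_commute_conj a c 1 1).
by rewrite !conjg1.
Qed.

Lemma carrierJ v g p : carrier (v ^ g) p <-> carrier v (g * p).
Proof. by split=> [] [a e]; exists a; rewrite -e conjgM. Qed.

Lemma carrier_gen a p : carrier (gen a ^ p^-1) p.
Proof. by exists a; rewrite conjgKV. Qed.

(** On its carrier [u] translates along a standard geodesic: [u^n p = p a^n], and only [u] is
    crossed. *)
Lemma carrier_neq_cross u v p n :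
  carrier u p -> v <> u -> cross v (u ^+ n * p) = cross v p.
Proof.
move=> [a ua] vu; rewrite conjgC conjXg ua.
rewrite (crossM_expgz _ _ _ (Posz n)) -ua (inj_eq (@conjg_inj G p)).
by case: eqP => // _; rewrite GRing.addr0.
Qed.

(* Evaluate [cross a] on both sides of [a^n h = h a^n]. *)
Lemma commute_expg_root u p n g :
  carrier u p -> 0 < n -> commute (u ^+ n) g -> commute u g.
Proof.
move=> [a ua] n0 /(commuteJ p); rewrite conjXg ua => ch.
suff: commute (gen a) (g ^ p) by rewrite -ua => /(commuteJ p^-1); rewrite !conjgK.
move: (g ^ p) ch => h ch; have := congr1 (cross (gen a)) ch.
rewrite crossM (crossM_expgz _ _ _ (Posz n)) (cross_expgz _ _ (Posz n)) eqxx.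
have -> : gen a ^ (gen a ^+ n) = gen a.
  by apply/commute_conjg; apply: commuteX.
by case: (_ ^ h =P _) => [/commute_conjg //|_]; lia.
Qed.

Lemma seq_pigeonhole (T : eqType) (f : nat -> T) (s : seq T) :
  (forall n, f n \in s) -> exists m n, m < n /\ f m = f n.
Proof.
move=> fs; have: ~~ uniq [seq f n | n <- iota 0 (size s).+1].
  apply/negP => /uniq_leq_size le.
  have : size [seq f n | n <- iota 0 (size s).+1] <= size s.
    by apply: le => x /mapP[n _ ->].
  by rewrite size_map size_iota ltnn.
move=> /(uniqPn (f 0))[m [n [mn]]]; rewrite size_map size_iota => ltn.
rewrite !(nth_map 0) ?size_iota ?nth_iota ?(ltn_trans mn ltn) //.
by exists m, n.
Qed.

(* The walls separating [u^n p] from [u^n q] are the [u^n]-translates of the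
   finitely many ones separating [p] from [q]; as no power of [u] fixes [v],
   they do not include [v] for suitable [n]. *)
Lemma cross_stable u v r p q :
    carrier u r -> ~ commute u v ->
    (forall n, cross v (u ^+ n * p) = cross v p) ->
    (forall n, cross v (u ^+ n * q) = cross v q) ->
  cross v p = cross v q.
Proof.
move=> ur nuv vp vq; apply/eqP; apply: contraT => npq.
have [s [_ ms _]] := dist_seq p q.
have [|m [n [mn e]]] := @seq_pigeonhole _ (fun n => v ^ (u ^+ n)) s.
  move=> n; rewrite ms; have := vp n; have := vq n; rewrite !crossM => eq ep.
  by apply: contra npq => /eqP e; rewrite -ep -eq e.
case: nuv; apply: (commute_expg_root ur (n := n - m)); first by rewrite subn_gt0.
apply/commute_sym/commute_conjg.
by rewrite expgnFr 1?ltnW // conjgM -e conjgK.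
Qed.

Lemma cross_carrier u v p q :
  carrier u p -> carrier u q -> ~ commute u v -> cross v p = cross v q.
Proof.
move=> up uq nuv; apply: (cross_stable up nuv) => n; apply: carrier_neq_cross => //.
all: by move=> vu; case: nuv; rewrite vu.
Qed.

(** Powers of [u1] move [p1] only across [u1] and preserve the carrier of [u2], where [cross v] is
    constant; so [cross_stable] applies. *)
Lemma cross_commuting_carriers u1 u2 v p1 p2 :
    commute u1 u2 -> ~ commute u1 v -> ~ commute u2 v ->
    carrier u1 p1 -> carrier u2 p2 ->
  cross v p1 = cross v p2.
Proof.
move=> u12 nu1 nu2 up1 up2; apply: (cross_stable up1 nu1) => n.
  by apply: carrier_neq_cross => // vu; case: nu1; rewrite vu.
apply: (cross_carrier (u := u2)) => //; apply/carrierJ.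
suff -> : u2 ^ (u1 ^+ n) = u2 by [].
by apply/commute_conjg/commuteX/commute_sym.
Qed.

(** By [cross_carrier] each carrier lies in one level of the other wall. If both conclusions fail, a
    geodesic from [p] to [q] meets the carrier of [u] at some [x] in the [u]-level of [p], and one
    from [p] to [x] meets the carrier of [v] at some [y]. Then [y], in the [u]-level of [q], lies
    between two points in the [u]-level of [p]. *)
Lemma wall_consistent u v p q r :
    ~ commute u v -> carrier v q -> carrier u r ->
  cross u p = cross u q \/ cross v p = cross v r.
Proof.
move=> nuv vq ur; have nvu : ~ commute v u by move=> /commute_sym.
case: (cross u p =P cross u q) => [|/eqP /cross_between]; first by left.
move=> [x [ux xp pxq]]; case: (cross v p =P cross v r) => [|npr]; first by right.
left; have : cross v p != cross v x.
  by rewrite (cross_carrier ux ur nuv); apply/eqP.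
move=> /cross_between[y [vy _ pyx]].
by rewrite -(cross_carrier vy vq nvu); case: (between_cross u pyx) => // ->.
Qed.

Lemma dist_expgz p a k : dist p (p * expgz (gen a) k) <= 1.
Proof.
rewrite /syllable_dist mulKg -[expgz _ _]mulg1.
have := @syllable_length_min V E [:: (a, k)].
by rewrite sprod_cons /syllable_prod big_nil.
Qed.

Lemma first_syllable p q : p <> q -> exists a k,
  let p1 := p * expgz (gen a) k in
  [/\ k != 0%R, between p p1 q & dist p1 q < dist p q].
Proof.
move=> npq; have [s szs sE] := syllable_length_ex (p^-1 * q).
have qE : q = p * syllable_prod E s by rewrite -sE mulVKg.
case: s szs sE qE => [_ _|[a k] s szs _ qE].
  by rewrite /syllable_prod big_nil mulg1 => e; case: npq.
exists a, k => p1; have d1 : dist p1 q <= size s.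
  by rewrite /syllable_dist qE sprod_cons (mulgA p) mulKg syllable_length_min.
have d2 : dist p q = (size s).+1 by rewrite -[RHS]/(size ((a, k) :: s)).
have d3 := dist_expgz p a k; have d4 := leq_dist_add p p1 q.
rewrite -/p1 in d3; split; rewrite /between; try by lia.
apply/eqP => k0; move: d1; rewrite /p1 k0 /= mulg1 d2; lia.
Qed.

Lemma last_syllable p q : p <> q -> exists x a k,
  [/\ k != 0%R, q = x * expgz (gen a) k, between p x q & dist p x < dist p q].
Proof.
move=> npq; have [|a [k]] := @first_syllable q p; first exact/nesym.
rewrite /between /=; set x := q * _ => -[k0 b lt].
exists x, a, (- k)%R; split; rewrite ?GRing.oppr_eq0 //.
- by rewrite /x -mulgA -expgzD GRing.addrN mulg1.
- by rewrite /between distC b addnC [dist x p]distC [dist q x]distC.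
- by rewrite distC [dist p q]distC.
Qed.

Lemma cross_step v p a k : k != 0%R ->
  (cross v p == cross v (p * expgz (gen a) k)) = (v ^ p != gen a).
Proof. by move=> k0; rewrite crossM_expgz; case: (_ ^ p =P _) => _; lia. Qed.

Lemma gen_conj_expgz a p k : gen a ^ (p * expgz (gen a) k)^-1 = gen a ^ p^-1.
Proof.
rewrite invgM conjgM; congr (_ ^ _); apply/commute_conjg/commuteV.
exact: commute_expgz.
Qed.

(* [y] is a point of the carrier of [v] closest to [p], and [x] is the point
   preceding it on a geodesic from [p]. *)
Lemma exit_carrier v p y0 : carrier v y0 -> ~ carrier v p ->
  exists u x y, [/\ [/\ carrier v y, carrier u y, carrier u x & ~ commute u v],
    cross u p <> cross u y /\ cross v p = cross v y,
    dist p x < dist p y & forall z, carrier v z -> dist p y <= dist p z].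
Proof.
move=> vy0 nvp.
have ex : exists n, `[< exists2 y, carrier v y & dist p y = n >].
  by exists (dist p y0); apply/asboolP; exists y0.
have [n /asboolP[y vy dy] ymin] := ex_minnP ex.
have {}ymin z : carrier v z -> dist p y <= dist p z.
  by move=> vz; rewrite dy; apply: ymin; apply/asboolP; exists z.
have [|x [a [k [k0 yE b lt]]]] := @last_syllable p y.
  by move=> py; case: nvp; rewrite py.
have uE : gen a ^ x^-1 = gen a ^ y^-1 by rewrite yE gen_conj_expgz.
exists (gen a ^ x^-1), x, y; split=> //; split=> //.
- by rewrite uE; apply: carrier_gen.
- exact: carrier_gen.
(* If [u] commuted with [v], then [x] would also lie on the carrier of [v], nearer to [p] than
   [y]. *)
- move=> uv; have: dist p y <= dist p x; last by rewrite leqNgt lt.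
  apply: ymin; case: vy => c vc; exists c; move: uv; rewrite uE => /(commuteJ y).
  have -> : x = y * (expgz (gen a) k)^-1 by rewrite yE mulgK.
  rewrite conjgKV conjgM vc => cac; apply/commute_conjg/commuteV.
  exact/commute_expgz/commute_sym.
- have : cross (gen a ^ x^-1) x != cross (gen a ^ x^-1) y.
    by rewrite yE cross_step // conjgKV eqxx.
  by case: (between_cross (gen a ^ x^-1) b) => [->|->]; move/eqP.
(* Otherwise a geodesic from [p] to [y] meets the carrier of [v] at the level of [p]; by minimality
   that point is [y]. *)
- case: (cross v p =P cross v y) => // /eqP /cross_between[z [vz zp pzy]].
  move: pzy (ymin _ vz); rewrite /between => -> le.
  have /dist0 zy : dist z y = 0 by lia.
  by move: zp; rewrite zy => ->.
Qed.

End Carriers.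

(** * Components of the complement of a star *)

Section Links.
Variables (V : finType) (E : sgraph V).
Local Notation G := (raag E).
Local Notation gen := (raag_gen E).
Local Notation dist := (@syllable_dist V E).
Local Notation H := (ext_vertex E).
Implicit Types (p q g : G) (a b c : V) (u v w : H).

Fact wall_subproof a p : ext_vertex_pred (gen a ^ p^-1 : G).
Proof. by apply/asboolP; exists a, p^-1. Qed.
Definition wall a p : H := ExtVertex (wall_subproof a p).

Lemma wall_carrier a p : carrier (wall a p : G) p.
Proof. exact: carrier_gen. Qed.

Lemma carrier_wall v p : carrier (v : G) p -> exists a, v = wall a p.
Proof. by move=> [a va]; exists a; apply/val_inj; rewrite /= -va conjgK. Qed.

Lemma ext_vertex_carrier v : exists p, carrier (v : G) p.
Proof.
have /asboolP[a [h ->]] := ext_valP v.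
by exists h^-1; rewrite -{1}[h]invgK; apply: carrier_gen.
Qed.

Definition cstar v : {pred H} := fun x => `[< commute (x : G) (v : G) >].

Lemma cstarP v (x : H) : reflect (commute (x : G) (v : G)) (cstar v x).
Proof. exact: asboolP. Qed.

Lemma cstarC v x : cstar v x = cstar x v.
Proof. by apply/cstarP/cstarP => /commute_sym. Qed.

Lemma cstar_wall a b p : cstar (wall b p) (wall a p) = `[< commute (gen a) (gen b) >].
Proof.
apply/cstarP/asboolP => [/(commuteJ p)|/(commuteJ p^-1)] //=.
by rewrite !conjgKV.
Qed.

Lemma cstar_wall_adj a b p : E a b -> cstar (wall b p) (wall a p).
Proof. by move=> ab; rewrite cstar_wall; apply/asboolP/gen_commute. Qed.

(* [x] and [y] are in the same component of the complement of the star of [v]. *)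
Definition linked v (x y : H) := forall W : H -> Prop,
  (forall x y : H, ~~ cstar v x -> ~~ cstar v y -> cstar x y -> W x -> W y) ->
  W x -> W y.

Lemma linked_refl v x : linked v x x. Proof. by []. Qed.

Lemma linked_trans v x y z : linked v x y -> linked v y z -> linked v x z.
Proof. by move=> xy yz W WP /(xy W WP); apply: yz. Qed.

Lemma linked_step v x y :
  ~~ cstar v x -> ~~ cstar v y -> cstar x y -> linked v x y.
Proof. by move=> vx vy xy W; apply. Qed.

Lemma linked_sym v x y : linked v x y -> linked v y x.
Proof.
move=> xy W WP Wy; apply: contrapT => nWx.
(* Steps are reversible, so the complement of a closed set is closed. *)
apply: (xy (fun z => ~ W z)) => // s t vs vt st nWs Wt.
by apply: nWs; apply: WP Wt => //; rewrite cstarC.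
Qed.

Lemma linked_cross v (x y : H) p q :
  ~~ cstar v x -> ~~ cstar v y -> linked v x y ->
  carrier (x : G) p -> carrier (y : G) q -> cross (v : G) p = cross (v : G) q.
Proof.
move=> vx vy xy xp yq.
pose W z := forall r, carrier (z : G) r -> cross (v : G) p = cross (v : G) r.
apply: (xy W) yq => [s t /cstarP vs /cstarP vt /cstarP st Ws r tr|r xr].
  have [z sz] := ext_vertex_carrier s.
  by rewrite (Ws z sz); apply: cross_commuting_carriers (commute_sym st) vs vt sz tr.
by apply: (cross_carrier xp xr); apply/cstarP.
Qed.

(** [b] and [c] are the labels of [v] and of the wall [u] from [exit_carrier]. Since [u] separates
    [p] from the carrier of [v], a wall at [p] commuting with [v] must commute with [u] too. *)
Lemma star_off_carrier v p : ~ carrier (v : G) p -> exists b c, [/\ b <> c,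
  ~ E c b & forall a, cstar v (wall a p) -> E c a /\ (a = b \/ E b a)].
Proof.
move=> nvp; have [y0 vy0] := ext_vertex_carrier v.
have [u [_ [y [[[b vb] [c uc] _ nuv] [upy _] _ _]]]] := exit_carrier vy0 nvp.
have nbc : ~ commute (gen c) (gen b).
  by rewrite -uc -vb => /(commuteJ y^-1); rewrite !conjgK.
exists b, c; split=> [bc|cb|a /cstarP av].
- by apply: nbc; rewrite bc.
- exact/nbc/gen_commute.
have au : commute (wall a p : G) u.
  apply: contrapT => nau; apply: upy.
  apply: (@cross_commuting_carriers V E (wall a p) v u) => //.
  - by move/commute_sym.
  - exact: wall_carrier.
  - by exists b.
have ab : a = b \/ E a b.
  apply: (@gen_commute_conj V E a b p^-1 y^-1).
  by move: av; rewrite -vb conjgK.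
have ac : a = c \/ E a c.
  by apply: (@gen_commute_conj V E a c p^-1 y^-1); rewrite -uc conjgK.
have nca : a <> c.
  move=> ac'; apply: nbc; apply/gen_commuteP; rewrite -ac'.
  by case: ab; [left | right].
split; first by case: ac => // ac; rewrite adj_sym.
by case: ab; [left | rewrite adj_sym; right].
Qed.

(** For a failing pair the link of [a] lies in the star of [b], so that [a |-> a b] defines an
    automorphism. *)
Definition no_transvection := forall a b, a <> b ->
  exists2 x : V, E a x & ~ commute (gen x) (gen b).
Definition no_separating_star := forall b (W : V -> Prop),
    (forall x y : V, ~ commute (gen x) (gen b) -> ~ commute (gen y) (gen b) ->
       E x y -> W x -> W y) ->
  forall x y : V, ~ commute (gen x) (gen b) -> ~ commute (gen y) (gen b) -> W x -> W y.
Definition no_central_vertex := forall b, exists x : V, ~ commute (gen x) (gen b).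

Hypothesis noT : no_transvection.
Hypothesis noS : no_separating_star.
Hypothesis noC : no_central_vertex.

Lemma off_star v p : exists2 x : H, carrier (x : G) p & ~~ cstar v x.
Proof.
have /asboolP[b [h vE]] := ext_valP v; have [a nab] := noC b.
exists (wall a p); first exact: wall_carrier.
apply/cstarP; rewrite vE /= => /gen_commute_conj /gen_commuteP.
exact: nab.
Qed.

Lemma noTE a b : a <> b -> exists x : V, [/\ E a x, x <> b & ~ E b x].
Proof.
move=> /noT[x ax nxb]; exists x; split=> // [xb|bx]; apply: nxb.
  by rewrite xb.
exact/commute_sym/gen_commute.
Qed.

Lemma linked_star_complement v p c :
  (forall a, ~ commute (gen a) (gen c) -> ~~ cstar v (wall a p)) ->
  forall a b, ~ commute (gen a) (gen c) -> ~ commute (gen b) (gen c) ->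
  linked v (wall a p) (wall b p).
Proof.
move=> vP a b ac bc; pose W x := linked v (wall a p) (wall x p).
suff WP (x y : V) : ~ commute (gen x) (gen c) -> ~ commute (gen y) (gen c) ->
    E x y -> W x -> W y by exact: (noS WP ac bc (@linked_refl v _)).
move=> xc yc xy ax; apply: (linked_trans ax).
by apply: linked_step (vP _ xc) (vP _ yc) _; apply: cstar_wall_adj; rewrite adj_sym.
Qed.

(** On the carrier of [v] this is connectedness outside the star of the label of [v]. Off it, the
    star of [v] at [p] lies in the link of [c]; the labels outside the star of [c] are linked
    together, and all other walls are one step from [wall c p]. *)
Lemma linked_at v p a b :
  ~~ cstar v (wall a p) -> ~~ cstar v (wall b p) ->
  linked v (wall a p) (wall b p).
Proof.
case: (pselect (carrier (v : G) p)) => [/carrier_wall[c ->]|nvp].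
  rewrite !cstar_wall => /asboolP ac /asboolP bc.
  by apply: linked_star_complement ac bc => x xc; rewrite cstar_wall; apply/asboolP.
have [b0 [c [bc ncb Sv]]] := star_off_carrier nvp.
have out x : ~ E c x -> ~~ cstar v (wall x p).
  by move=> ncx; apply/negP => /Sv[].
have vc : ~~ cstar v (wall c p) by apply: out; rewrite adj_irr.
have out' x : ~ commute (gen x) (gen c) -> ~~ cstar v (wall x p).
  by move=> xc; apply: out => /gen_commute/commute_sym.
(* The path [c], [z], [y] joins [c] to the labels outside its star while avoiding the star of
   [v]. *)
have [z [cz zb nbz]] := noTE (nesym bc).
have vz : ~~ cstar v (wall z p) by apply/negP => /Sv[_ []].
have [|y [zy yc ncy]] := @noTE z c; first by move=> zc; rewrite zc adj_irr in cz.
have nyc : ~ commute (gen y) (gen c).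
  by move=> /gen_commuteP[//|]; rewrite adj_sym.
suff toc x : ~~ cstar v (wall x p) -> linked v (wall x p) (wall c p).
  by move=> va vb; apply: linked_trans (toc _ va) (linked_sym (toc _ vb)).
move=> vx; case: (pselect (commute (gen x) (gen c))) => xc.
  by apply: linked_step => //; rewrite cstar_wall; apply/asboolP/commute_sym.
apply: linked_trans (linked_star_complement out' xc nyc) _.
apply: (@linked_trans _ _ (wall z p)); apply: linked_step => //.
- exact: out'.
- exact: cstar_wall_adj.
- exact: cstar_wall_adj.
Qed.

(** Any label adjacent to [a] gives a wall through both ends; [no_transvection] supplies one off the
    star of [v]. *)
Lemma common_wall v p a k :
  cross (v : G) p = cross (v : G) (p * expgz (gen a) k) -> k != 0%R ->
  exists z, ~~ cstar v (wall z p) /\ wall z p = wall z (p * expgz (gen a) k).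
Proof.
move=> pq k0; suff [z [az vz]] : exists z, E a z /\ ~~ cstar v (wall z p).
  exists z; split=> //; apply/val_inj; rewrite /= invgM conjgM; congr (_ ^ _).
  apply/esym/commute_conjg/commuteV/commute_expgz.
  exact/commute_sym/gen_commute.
move/eqP: pq; rewrite cross_step // => /eqP va.
case: (pselect (carrier (v : G) p)) => [/carrier_wall[c vE]|nvp].
  have [|z az zc] := @noT a c.
    by move=> ac; apply: va; rewrite vE /= conjgKV ac.
  by exists z; split=> //; rewrite vE cstar_wall; apply/asboolP.
have [b [c [bc ncb Sv]]] := star_off_carrier nvp.
(* Labels at [p] in the star of [v] lie in the link of [c] and in the star of [b]; the second
   condition is broken if [a = c], the first otherwise. *)
case: (pselect (a = c)) => [->|ac].
  have [z [cz zb nbz]] := noTE (nesym bc).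
  by exists z; split=> //; apply/negP => /Sv[_ []].
by have [z [az zc ncz]] := noTE ac; exists z; split=> //; apply/negP => /Sv[].
Qed.

(** A geodesic from [p] to [q] does not cross [v], so consecutive points share a wall off the star
    of [v]; [linked_at] joins these walls at each point. *)
Lemma cross_linked v (x y : H) p q :
    ~~ cstar v x -> ~~ cstar v y -> carrier (x : G) p -> carrier (y : G) q ->
  cross (v : G) p = cross (v : G) q -> linked v x y.
Proof.
have [n] := ubnP (dist p q); elim: n p x => // n IHn p x ltn vx vy xp yq pq.
case: (pselect (p = q)) => [epq|/first_syllable[a [k [k0 b lt]]]].
  move: yq vx vy; rewrite -epq; case/carrier_wall: xp => a ->.
  by case/carrier_wall=> c ->; apply: linked_at.
set p1 := p * _ in b lt; have pp1 : cross (v : G) p = cross (v : G) p1.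
  by case: (between_cross (v : G) b) => // ->.
have [z [vz zE]] := common_wall pp1 k0.
apply: (@linked_trans _ _ (wall z p)).
  by case/carrier_wall: xp vx => c -> vc; apply: linked_at.
rewrite zE in vz *; apply: (IHn p1) => //; first exact: leq_trans lt _.
  exact: wall_carrier.
by rewrite -pp1.
Qed.

End Links.

(** * From automorphisms to isometries *)

Section WallCoordinates.
Variables (V : finType) (E : sgraph V).
Local Notation G := (raag E).
Local Notation gen := (raag_gen E).
Local Notation dist := (@syllable_dist V E).
Local Notation H := (ext_vertex E).
Implicit Types (p q g : G) (a b c : V) (u v w : H).

Lemma carrier_ext (u : G) p : carrier u p -> exists v : H, u = v.
Proof. by move=> [a ua]; exists (wall a p); rewrite /= -ua conjgK. Qed.

Lemma dist_wall_seq p q : exists s : seq H,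
  [/\ uniq s, forall v, (v \in s) = (cross (v : G) p != cross (v : G) q)
    & size s = dist p q].
Proof.
have [s [us ms <-]] := dist_seq p q.
(* A separating element has a nonempty carrier, hence is conjugate to a generator, and [insub] drops
   nothing. *)
have sE : [seq val v | v <- pmap (insub : G -> option H) s] = s.
  rewrite (pmap_filter (insubK _)); apply/all_filterP/allP => v; rewrite ms.
  move=> /cross_between[x [/carrier_ext[w ->] _ _]].
  by rewrite isSome_insub; apply: ext_valP.
exists (pmap (insub : G -> option H) s); split.
- by rewrite pmap_sub_uniq.
- by move=> v; rewrite mem_pmap_sub ms.
- by rewrite -[in RHS]sE size_map.
Qed.

Lemma dist_wall_uniq p q (s : seq H) : uniq s ->
  (forall v, (v \in s) = (cross (v : G) p != cross (v : G) q)) ->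
  dist p q = size s.
Proof.
move=> us ms; have [t [ut mt <-]] := dist_wall_seq p q.
by apply/perm_size/uniq_perm => // v; rewrite ms mt.
Qed.

Lemma cross_wall_inj p q : (forall v, cross (v : G) p = cross (v : G) q) -> p = q.
Proof.
by move=> pq; apply/dist0/(@dist_wall_uniq _ _ [::]) => // v; rewrite pq eqxx.
Qed.

(** Expresses carriers by coordinates: off the carrier of [w], the wall [u] of [exit_carrier]
    separates [p] from it. *)
Lemma carrierP w p : carrier (w : G) p <-> forall u r,
  ~~ cstar w u -> carrier (w : G) r -> cross (u : G) p = cross (u : G) r.
Proof.
split=> [wp u r /cstarP uw wr|wP].
  by apply: cross_carrier wp wr _ => /commute_sym.
apply: contrapT => nwp; have [r0 wr0] := ext_vertex_carrier w.
have [u [x [y [[wy _ ux uw] [upy _] _ _]]]] := exit_carrier wr0 nwp.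
have [u' u'E] := carrier_ext ux; rewrite u'E in upy uw.
by apply: upy; apply: wP => //; apply/cstarP.
Qed.

(* The graph of the map on points induced by [f]. *)
Definition corresponds (f : H -> H) p q :=
  forall w, carrier (w : G) p <-> carrier (f w : G) q.

Hypothesis noT : no_transvection E.
Hypothesis noS : no_separating_star E.
Hypothesis noC : no_central_vertex E.

(** By [off_star] the two points share a wall outside the star of any given [v], and it fixes their
    coordinate at [v]. *)
Lemma corresponds_inj f p q q' : (forall v, exists w, v = f w) ->
  corresponds f p q -> corresponds f p q' -> q = q'.
Proof.
move=> fS pq pq'; apply: cross_wall_inj => v.
have [x xq vx] := off_star noC v q; have [w xw] := fS x; subst x.
apply: (cross_carrier xq); first by apply/pq'/pq.
by apply/cstarP.
Qed.

Variable f : Sym H.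
Hypothesis fC : forall u v, cstar (f u) (f v) = cstar u v.

Lemma linked_image v x y : linked v x y -> linked (f v) (f x) (f y).
Proof.
move=> xy W WP; apply: (xy (fun z => W (f z))) => s t vs vt st.
by apply: WP; rewrite fC.
Qed.

Lemma linked_preimage v x y : linked (f v) (f x) (f y) -> linked v x y.
Proof.
move=> xy W WP Wx.
have := xy (fun z => W (sym_inv f z)); rewrite /= !sym_funK; apply=> // s t.
rewrite -[s](sym_invK f) -[t](sym_invK f) !fC => vs vt st.
by rewrite !sym_funK; apply: WP.
Qed.

(** Each equality says that the two walls lie in one component off the star, and [f] preserves these
    components. *)
Lemma cross_image v x y p q p' q' : ~~ cstar v x -> ~~ cstar v y ->
    carrier (x : G) p -> carrier (y : G) q ->
    carrier (f x : G) p' -> carrier (f y : G) q' ->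
  cross (v : G) p = cross (v : G) q <-> cross (f v : G) p' = cross (f v : G) q'.
Proof.
move=> vx vy xp yq xp' yq'; split.
  move=> /(cross_linked noT noS vx vy xp yq)/linked_image.
  by move=> /linked_cross; apply; rewrite ?fC.
move=> e; apply: (linked_cross vx vy _ xp yq); apply: linked_preimage.
by apply: cross_linked e => //; rewrite fC.
Qed.

Lemma corresponds_dist p q p' q' :
  corresponds f p q -> corresponds f p' q' -> dist q q' = dist p p'.
Proof.
move=> pq pq'; have [s [us ms <-]] := dist_wall_seq p p'.
rewrite -(size_map f); apply: dist_wall_uniq => [|v].
  by rewrite map_inj_uniq //; apply: can_inj (sym_funK f).
rewrite -[v](sym_invK f) mem_map; last exact: can_inj (sym_funK f).
rewrite ms; move: (sym_inv f v) => {}v.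
have [x xp vx] := off_star noC v p; have [y yp vy] := off_star noC v p'.
have := cross_image vx vy xp yp (proj1 (pq x) xp) (proj1 (pq' y) yp).
by move=> e; congr (~~ _); apply/eqP/eqP => /e.
Qed.

Section Target.
(* [t v] is the coordinate at the wall [f v] of the image of [p]. *)
Variable p : G.
Variable t : H -> int.
Hypothesis tP : forall v w r, carrier (w : G) p -> ~~ cstar v w ->
  carrier (f w : G) r -> cross (f v : G) r = t v.

(** This is [wall_consistent] at [p], with each coordinate equality carried over by [f] in
    [half]. *)
Lemma target_consistent u v q r : ~~ cstar u v ->
    carrier (f v : G) q -> carrier (f u : G) r ->
  t u = cross (f u : G) q \/ t v = cross (f v : G) r.
Proof.
have half x y z : ~~ cstar x y -> carrier (f y : G) z ->
  forall r, carrier (y : G) r -> cross (x : G) p = cross (x : G) r ->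
  t x = cross (f x : G) z.
  move=> xy yz s ys; have [e ep xe] := off_star noC x p.
  have [r' er'] := ext_vertex_carrier (f e).
  move=> /(cross_image xe xy ep ys er' yz) <-; apply/esym; exact: tP er'.
move=> uv vq ur; have [q0 vq0] := ext_vertex_carrier v.
have [r0 ur0] := ext_vertex_carrier u.
case: (@wall_consistent V E u v p q0 r0) => // [/commute_sym/cstarP|e|e].
- exact/negP.
- by left; apply: half uv vq _ vq0 e.
- by right; apply: half ur _ ur0 e; rewrite cstarC.
Qed.

(** Induction on a list containing the walls where [q] has a wrong coordinate: moving along such a
    wall through [q] corrects it and changes no other coordinate. *)
Lemma target_reached q (s : seq H) :
    (forall v, cross (f v : G) q <> t v -> v \in s) ->
  exists q', forall v, cross (f v : G) q' = t v.
Proof.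
have [n] := ubnP (size s); elim: n s q => // n IHn s q lts sP.
case: (pselect (exists v, cross (f v : G) q <> t v)) => [[v0 bad0]|noex]; last first.
  by exists q => v; apply: contrapT => bad; apply: noex; exists v.
suff [v bad vq] : exists2 v, cross (f v : G) q <> t v & carrier (f v : G) q.
  have [a va] := vq; pose q1 := q * expgz (gen a) (t v - cross (f v : G) q)%R.
  apply: (IHn [seq w <- s | w != v] q1) => [|w].
    have c0 : 0 < count (pred1 v) s by rewrite -has_count has_pred1 sP.
    have -> : size [seq w <- s | w != v] = count (predC (pred1 v)) s.
      by rewrite size_filter; apply: eq_count.
    by move: lts c0; rewrite -(count_predC (pred1 v) s); lia.
  rewrite crossM_expgz -va (inj_eq (@conjg_inj G q)) mem_filter => bw.
  have wv : w != v by apply/eqP => wv; move: bw; rewrite wv eqxx; lia.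
  rewrite wv sP // => e; apply: bw; rewrite e.
  case: eqP => [/val_inj/(can_inj (sym_funK f)) wv'|_].
    by rewrite wv' eqxx in wv.
  by rewrite GRing.addr0.
(* A wrong wall [v] with carrier nearest to [q] passes through [q]: otherwise the wall of
   [exit_carrier] has a nearer carrier, so its coordinate is right, and [target_consistent] makes
   that of [v] right too. *)
pose P n := `[< exists v y,
  [/\ cross (f v : G) q <> t v, carrier (f v : G) y & dist q y = n] >].
have exP : exists n, P n.
  have [y0 vy0] := ext_vertex_carrier (f v0).
  by exists (dist q y0); apply/asboolP; exists v0, y0.
case: (ex_minnP exP) => m /asboolP[v [y1 [bad vy1 dy1]]] mmin.
exists v => //; apply: contrapT => nvq.
have [u [x [y [[vy uy ux nuv] [uqy vqy] ltx ymin]]]] := exit_carrier vy1 nvq.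
have [u1 u1E] := carrier_ext ux; rewrite u1E in uy ux nuv uqy.
rewrite -[u1](sym_invK f) in uy ux nuv uqy.
have uq : cross (f (sym_inv f u1) : G) q = t (sym_inv f u1).
  apply: contrapT => badu; have: m <= dist q x.
    by apply: mmin; apply/asboolP; exists (sym_inv f u1), x.
  by have := ymin _ vy1; lia.
case: (@target_consistent (sym_inv f u1) v y y) => //.
- by rewrite -fC; apply/cstarP => /commute_sym.
- by rewrite -uq.
- by rewrite -vqy => e; case: bad.
Qed.

End Target.

Lemma corresponds_ex p : exists q, corresponds f p q.
Proof.
have /choice[e eP] v : exists e : H * G,
    [/\ carrier (e.1 : G) p, ~~ cstar v e.1 & carrier (f e.1 : G) e.2].
  have [x xp vx] := off_star noC v p.
  by have [r xr] := ext_vertex_carrier (f x); exists (x, r).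
pose t v := cross (f v : G) (e v).2.
have tP v w r : carrier (w : G) p -> ~~ cstar v w -> carrier (f w : G) r ->
    cross (f v : G) r = t v.
  move=> wp vw wr; have [ep ve er] := eP v.
  exact/(cross_image vw ve wp ep wr er).
have /choice[r rP] (a : V) : exists r, carrier (f (wall a p) : G) r.
  exact: ext_vertex_carrier.
have /choice[s sP] (a : V) : exists s : seq H,
    forall v, (v \in s) = (cross (v : G) 1 != cross (v : G) (r a)).
  by have [s [_ sP _]] := dist_wall_seq 1 (r a); exists s.
(* If [1] is wrong at [f v], then [f v] separates [1] from [r a] for any [a] whose wall at [p] is
   off the star of [v]; this leaves finitely many walls. *)
pose S := flatten [seq [seq sym_inv f v | v <- s a] | a <- enum V].
have [|q qP] := @target_reached p t tP 1 S.
  move=> v bad; apply/flattenP; have [ep ve er] := eP v.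
  have [a aE] := carrier_wall ep; rewrite aE in ve er.
  exists [seq sym_inv f v | v <- s a]; first by apply: map_f; rewrite mem_enum.
  rewrite -[v](sym_funK f); apply: map_f; rewrite sP; apply/eqP => e1; apply: bad.
  by rewrite e1; apply: tP (rP a) => //; apply: wall_carrier.
exists q => w; split=> [wp|wq].
  apply/carrierP => u r0; rewrite -[u](sym_invK f) fC => wu wr0.
  by rewrite qP; apply/esym/(tP _ w) => //; rewrite cstarC.
apply/carrierP => u r0 wu wr0; have [ep ue er] := eP u.
have uw : ~~ cstar u w by rewrite cstarC.
by apply/(cross_image ue uw ep wr0 er wq); rewrite qP.
Qed.

End WallCoordinates.

(** * From isometries to automorphisms *)

Section Edges.
Variables (V : finType) (E : sgraph V).
Local Notation G := (raag E).
Local Notation gen := (raag_gen E).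
Local Notation dist := (@syllable_dist V E).
Local Notation H := (ext_vertex E).
Implicit Types (p q r x y z : G) (a b c : V) (u v w : H).

(** An edge joins any two points of a standard geodesic: its ends differ by a nonzero power of a
    generator. *)
Definition edge v x y := forall w, (cross (w : G) x != cross (w : G) y) = (w == v).

Lemma edge_sym v x y : edge v x y -> edge v y x.
Proof. by move=> e w; rewrite eq_sym e. Qed.

Lemma edge_neq v x y : edge v x y -> cross (v : G) x <> cross (v : G) y.
Proof. by move=> /(_ v); rewrite eqxx => /eqP. Qed.

Lemma edge_cross v w x y : edge v x y -> w <> v -> cross (w : G) x = cross (w : G) y.
Proof. by move=> e wv; apply/eqP; rewrite -[_ == _]negbK e; apply/eqP. Qed.

Lemma edge_inj v w x y : edge v x y -> edge w x y -> v = w.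
Proof. by move=> ev ew; apply/eqP; rewrite -ew ev. Qed.

Lemma edge_dist v x y : edge v x y -> dist x y = 1%N.
Proof. by move=> e; apply: (@dist_wall_uniq _ _ _ _ [:: v]) => // w; rewrite e inE. Qed.

Lemma dist_edge x y : dist x y = 1%N -> exists v, edge v x y.
Proof.
have [[|v [|v' s]] [us ms <-]] // := dist_wall_seq x y.
by exists v => w; rewrite -ms inE.
Qed.

Lemma edge_carrier v x y : edge v x y -> carrier (v : G) x.
Proof.
move=> e; have /eqP/cross_between[z [vz zx]] := edge_neq e.
rewrite /between (edge_dist e) => d.
have [/dist0 -> //|/dist0 zy] : dist x z = 0 \/ dist z y = 0 by lia.
by case: (edge_neq e); rewrite -zy.
Qed.

Lemma carrier_edge v p a k :
  (v : G) ^ p = gen a -> k != 0%R -> edge v p (p * expgz (gen a) k).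
Proof.
move=> va k0 w; rewrite cross_step // negbK -va (inj_eq (@conjg_inj G p)).
by apply/eqP/eqP => [/val_inj|->].
Qed.

Lemma carrier_level v p k : carrier (v : G) p -> exists x,
  cross (v : G) x = k /\ forall w, w <> v -> cross (w : G) x = cross (w : G) p.
Proof.
move=> [a va]; exists (p * expgz (gen a) (k - cross (v : G) p)%R).
rewrite crossM_expgz va eqxx; split; first by lia.
move=> w wv; rewrite crossM_expgz -va (inj_eq (@conjg_inj G p)).
by case: eqP => [/val_inj|_]; rewrite ?GRing.addr0.
Qed.

(** Turns a coordinate equality into distances, which isometries keep: if [v] does not separate [x]
    from [y], it is the one extra wall between [x] and [z]. *)
Lemma edge_away v x y z :
  edge v y z -> dist x z = dist x y + 1%N <-> cross (v : G) x = cross (v : G) y.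
Proof.
move=> e; split=> [d|xy].
  have /between_cross -/(_ v)[//|yz] : between x y z.
    by rewrite /between d (edge_dist e).
  by case: (edge_neq e).
have [s [us ms <-]] := dist_wall_seq x y.
rewrite addn1 -[RHS]/(size (v :: s)); apply: dist_wall_uniq => [|w] /=.
  by rewrite ms xy eqxx.
rewrite inE ms; case: eqP => [->|/(edge_cross e) -> //].
by apply/esym/eqP; rewrite xy; apply: edge_neq e.
Qed.

Lemma cross_wall_self v : cross (v : G) (v : G) = 1%R.
Proof.
have [p vp] := ext_vertex_carrier v; have [a va] := vp.
have := crossM (v : G) v p.
rewrite (_ : (v : G) ^ (v : G) = v :> G); last exact/commute_conjg.
by rewrite conjgC va (crossM_expgz _ _ _ (Posz 1)) va eqxx; lia.
Qed.

Lemma cross_wall_commuting u v :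
  commute (u : G) (v : G) -> u <> v -> cross (v : G) (u : G) = 0%R.
Proof.
move=> uv nuv; have [p up] := ext_vertex_carrier u.
have vu : (v : G) <> u by move=> /val_inj vu; apply: nuv.
have := carrier_neq_cross 1 up vu; rewrite expg1 crossM.
have -> : (v : G) ^ (u : G) = v :> G by apply/commute_conjg/commute_sym.
by lia.
Qed.

Definition quadrants u v := exists p q r s : G,
  [/\ cross (u : G) p = cross (u : G) q, cross (u : G) r = cross (u : G) s,
      cross (v : G) p = cross (v : G) r, cross (v : G) q = cross (v : G) s
    & cross (u : G) p <> cross (u : G) r /\ cross (v : G) p <> cross (v : G) q].

Lemma commute_quadrants u v : cstar u v -> u <> v -> quadrants u v.
Proof.
move=> /cstarP vu nuv; have uv := commute_sym vu.
have cuv := cross_wall_commuting vu (nesym nuv).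
have cvu := cross_wall_commuting uv nuv.
exists 1, (v : G), (u : G), ((u : G) * (v : G)); rewrite !crossM.
rewrite (_ : (u : G) ^ (u : G) = u :> G); last exact/commute_conjg.
rewrite (_ : (v : G) ^ (u : G) = v :> G); last exact/commute_conjg.
by rewrite !cross1 !cross_wall_self cuv cvu.
Qed.

Lemma quadrants_commute u v : quadrants u v -> cstar u v.
Proof.
move=> [p [q [r [s [upq urs vpr vqs [upr vpq]]]]]].
apply/cstarP; apply: contrapT => nvu.
have [x ux] := ext_vertex_carrier u; have [y vy] := ext_vertex_carrier v.
(* One quadrant avoids both the [u]-level of the carrier of [v] and the [v]-level of the carrier of
   [u]. *)
have C z := @wall_consistent V E u v z y x (fun uv => nvu (commute_sym uv)) vy ux.
have := C p; have := C q; have := C r; have := C s.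
by rewrite -urs -upq -vpr -vqs; lia.
Qed.

Section Isometry.
Variable phi : G -> G.
Hypothesis phi_dist : forall x y, dist (phi x) (phi y) = dist x y.

Lemma edge_image v x y : edge v x y -> exists w, edge w (phi x) (phi y).
Proof. by move=> /edge_dist d; apply: dist_edge; rewrite phi_dist. Qed.

(** [y] and [z] differ at most at [v], so their images are at distance at most 1, but two distinct
    image walls would both separate them. *)
Lemma edge_image_line v w x y z :
  edge v x y -> edge v x z -> edge w (phi x) (phi y) -> edge w (phi x) (phi z).
Proof.
move=> xy xz wxy; have [w' wxz] := edge_image xz.
suff -> : w = w' by [].
apply: contrapT => ww'; have : dist y z <= 1.
  have [s [us ms <-]] := dist_wall_seq y z.
  rewrite -[1%N]/(size [:: v]); apply: uniq_leq_size => // u; rewrite ms inE.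
  apply: contraR => /eqP uv.
  by rewrite -(edge_cross xy uv) (edge_cross xz uv).
rewrite -phi_dist; have [s [us ms <-]] := dist_wall_seq (phi y) (phi z).
suff: size [:: w; w'] <= size s by move=> /leq_trans h /h.
apply: uniq_leq_size => [|u]; first by rewrite /= inE andbT; apply/eqP.
rewrite !inE ms => /orP[]/eqP->; apply/eqP.
  by rewrite -(edge_cross wxz ww'); apply/nesym/edge_neq.
by rewrite -(edge_cross wxy (nesym ww')); apply: edge_neq.
Qed.

(** By [edge_away], [w'] does not separate the images of corresponding ends. If it differed from
    [w], it would not separate [phi x1] from [phi x2], hence not [phi y1] from [phi y2]. *)
Lemma edge_image_parallel v w w' x1 x2 y1 y2 : edge v x1 x2 -> edge v y1 y2 ->
    cross (v : G) x1 = cross (v : G) y1 -> cross (v : G) x2 = cross (v : G) y2 ->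
  edge w (phi x1) (phi x2) -> edge w' (phi y1) (phi y2) -> w = w'.
Proof.
move=> vx vy e1 e2 wx wy; apply: contrapT => ww'.
have f1 : cross (w' : G) (phi x1) = cross (w' : G) (phi y1).
  by apply/(edge_away _ wy); rewrite !phi_dist; apply/(edge_away _ vy).
have f2 : cross (w' : G) (phi x2) = cross (w' : G) (phi y2).
  apply/(edge_away _ (edge_sym wy)); rewrite !phi_dist.
  exact/(edge_away _ (edge_sym vy)).
by case: (edge_neq wy); rewrite -f1 -f2; apply: edge_cross wx (nesym ww').
Qed.

Lemma wall_image v : exists w, forall x y, edge v x y -> edge w (phi x) (phi y).
Proof.
have [x1 vx1] := ext_vertex_carrier v; have [a va] := vx1.
have ex : edge v x1 (x1 * expgz (gen a) 1%R) by apply: carrier_edge.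
set x2 := x1 * _ in ex; have [w wx] := edge_image ex.
exists w => y1 y2 ey.
(* On the geodesic of [v] through [y1], the points [z1] and [z2] have the levels of the reference
   edge: their edge is parallel to that one and collinear with [y1], [y2]. *)
have [z1 [z1v z1w]] := carrier_level (cross (v : G) x1) (edge_carrier ey).
have [z2 [z2v z2w]] := carrier_level (cross (v : G) x2) (edge_carrier ey).
have ez : edge v z1 z2.
  move=> u; case: (u =P v) => [->|uv]; last by rewrite z1w // z2w // eqxx.
  by rewrite z1v z2v; apply/eqP/edge_neq.
have [w' wz] := edge_image ez.
have -> : w = w' by apply: edge_image_parallel ex ez _ _ wx wz; rewrite ?z1v ?z2v.
case: (cross (v : G) z1 =P cross (v : G) y1) => [zy|zy].
  have zy1 : z1 = y1.
    by apply: cross_wall_inj => u; case: (u =P v) => [-> //|]; apply: z1w.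
  by rewrite zy1 in ez wz *; apply: edge_image_line ez ey wz.
have ezy : edge v z1 y1.
  by move=> u; case: (u =P v) => [->|uv]; [apply/eqP | rewrite z1w // eqxx].
have wzy := edge_image_line ez ezy wz.
exact: edge_image_line (edge_sym ezy) ey (edge_sym wzy).
Qed.

End Isometry.

Section WallMap.
Variables (phi : G -> G) (f : H -> H).
Hypothesis f_inj : injective f.
Hypothesis f_edge : forall v x y, edge v x y -> edge (f v) (phi x) (phi y).

Lemma wall_map_carrier v p : carrier (v : G) p -> carrier (f v : G) (phi p).
Proof.
move=> [a va]; have e : edge v p (p * expgz (gen a) 1%R) by apply: carrier_edge.
exact: edge_carrier (f_edge e).
Qed.

(** No syllable of a geodesic from [p] to [q] crosses [v], so by injectivity of [f] no image edge
    crosses [f v]. *)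
Lemma wall_map_cross v p q : cross (v : G) p = cross (v : G) q ->
  cross (f v : G) (phi p) = cross (f v : G) (phi q).
Proof.
have [n] := ubnP (dist p q); elim: n p => // n IHn p ltn pq.
case: (pselect (p = q)) => [-> //|/first_syllable[a [k [k0 b lt]]]].
set p1 := p * _ in b lt; have pp1 : cross (v : G) p = cross (v : G) p1.
  by case: (between_cross (v : G) b) => // ->.
have e : edge (wall a p) p p1 by apply: carrier_edge => //=; rewrite conjgKV.
rewrite (edge_cross (f_edge e)) => [|/f_inj va]; last first.
  by case: (edge_neq e); rewrite -va.
by apply: IHn; [exact: leq_trans lt _ | rewrite -pp1].
Qed.

End WallMap.

Lemma quadrants_image (phi psi : G -> G) (f g : H -> H) u v :
    cancel f g -> cancel phi psi -> cancel g f ->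
    (forall v x y, edge v x y -> edge (f v) (phi x) (phi y)) ->
    (forall v x y, edge v x y -> edge (g v) (psi x) (psi y)) ->
  quadrants u v -> quadrants (f u) (f v).
Proof.
move=> fK phiK gK fe ge [p [q [r [s [upq urs vpr vqs [upr vpq]]]]]].
have fM := wall_map_cross (can_inj fK) fe.
have gM w x y : cross (f w : G) (phi x) = cross (f w : G) (phi y) ->
    cross (w : G) x = cross (w : G) y.
  by move=> /(wall_map_cross (can_inj gK) ge); rewrite fK !phiK.
exists (phi p), (phi q), (phi r), (phi s).
by split; do ?exact: fM; split=> /gM.
Qed.

Lemma isometry_wall_map (phi : Sym G) : (forall x y, dist (phi x) (phi y) = dist x y) ->
  exists f : Sym H, (forall u v, cstar (f u) (f v) = cstar u v)
                    /\ forall p, corresponds f p (phi p).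
Proof.
move=> phiD; pose psi := sym_inv phi.
have psiD x y : dist (psi x) (psi y) = dist x y by rewrite -phiD !sym_invK.
have /choice[f fe] := wall_image phiD; have /choice[g ge] := wall_image psiD.
have ex v : exists x y, edge v x y.
  have [p [a va]] := ext_vertex_carrier v.
  by exists p, (p * expgz (gen a) 1%R); apply: carrier_edge.
have fK : cancel f g.
  move=> v; have [x [y e]] := ex v; apply: (edge_inj _ e).
  by have := ge _ _ _ (fe _ _ _ e); rewrite /psi !sym_funK.
have gK : cancel g f.
  move=> v; have [x [y e]] := ex v; apply: (edge_inj _ e).
  by have := fe _ _ _ (ge _ _ _ e); rewrite /psi !sym_invK.
exists (MkSym fK gK); split=> [u v|p w] /=; last first.
  split=> [|/(wall_map_carrier ge)]; first exact: wall_map_carrier.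
  by rewrite fK /psi sym_funK.
have half f' g' (phi' psi' : G -> G) u' v' :
    cancel f' g' -> cancel g' f' -> cancel phi' psi' ->
    (forall v x y, edge v x y -> edge (f' v) (phi' x) (phi' y)) ->
    (forall v x y, edge v x y -> edge (g' v) (psi' x) (psi' y)) ->
    cstar u' v' -> cstar (f' u') (f' v').
  move=> fK' gK' phiK' fe' ge' uv; case: (pselect (u' = v')) => [->|nuv].
    by apply/cstarP.
  by apply: quadrants_commute; apply: quadrants_image (commute_quadrants uv nuv).
apply/idP/idP; last by apply: half fK gK (sym_funK phi) fe ge.
by move=> /(half _ _ _ _ _ _ gK fK (sym_invK phi) ge fe); rewrite !fK.
Qed.

End Edges.

(** * Consequences of the finiteness of the outer automorphism group *)

Section FiniteOut.
Variables (V : finType) (E : sgraph V).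
Local Notation G := (raag E).
Local Notation gen := (raag_gen E).
Local Notation Z := (Algebra.to_multiplicative int).

Lemma finite_Out_inner (tau : nat -> Aut G) : finite_Out G ->
  exists m n g, m < n /\ forall x, tau n x = (tau m x : G) ^ g.
Proof.
move=> /finite_seqP[s sE]; pose cls n : Out G := \pi_(Out G)%qT (tau n).
have [|m [n [mn]]] := @seq_pigeonhole _ cls s.
  by move=> n; have : [set: Out G]%classic (cls n) by []; rewrite sE.
(* [tau m^-1 * tau n] is conjugation by [g]; applying [tau m] turns it into conjugation by
   [tau m g]. *)
move=> /eqmodP/asboolP[g gE]; exists m, n, (tau m g); split=> // x.
have := gE x; rewrite /conjg -[sym_fun _ _]/(sym_inv (tau m) (tau n x)).
move=> /(congr1 (tau m)).
rewrite sym_invK => ->; have /asboolP tM := autP (tau m).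
have t1 : tau m 1 = 1 by apply: (mulgI (tau m 1)); rewrite -tM !mulg1.
rewrite !tM; congr (_ * _); apply: (mulIg (tau m g)).
by rewrite -tM !mulVg.
Qed.

Lemma raag_aut (f g : V -> G) (F1 F2 : UMagmaMorphism.type G G) :
    (forall a, F1 (gen a) = f a) -> (forall a, F2 (gen a) = g a) ->
    (forall a, F1 (g a) = gen a) -> (forall a, F2 (f a) = gen a) ->
  exists tau : Aut G, forall x, tau x = F1 x.
Proof.
move=> F1E F2E F1g F2f.
have F12 : cancel F1 F2.
  move=> x; apply: (raag_hom_ext (F1 := F2 \o F1) (F2 := idfun)) => a /=.
  by rewrite F1E.
have F21 : cancel F2 F1.
  move=> x; apply: (raag_hom_ext (F1 := F1 \o F2) (F2 := idfun)) => a /=.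
  by rewrite F2E.
have M : group_aut (MkSym F12 F21) by apply/asboolP; exact: gmulfM.
by exists (MkAut M).
Qed.

Lemma expgz_int k : expgz (1%R : Z) k = k.
Proof.
elim/int_rec: k => [//|n IH|n IH].
  by rewrite -addn1 PoszD expgzS IH.
by rewrite -addn1 PoszD GRing.opprD expgz_pred IH.
Qed.

(** The exponent sum of [b] in the image of [a] under [a |-> a b^k] is [k], so these powers have
    distinct outer classes. *)
Lemma finite_Out_no_transvection : finite_Out G -> no_transvection E.
Proof.
move=> fin a b /eqP ab; apply: contrapT => noex.
have lkst x : E a x -> commute (gen x) (gen b).
  by move=> ax; apply: contrapT => nxb; apply: noex; exists x.
pose f k x := if x == a then gen a * expgz (gen b) k else gen x.
have /choice[F FE] (k : int) :
    exists F : UMagmaMorphism.type G G, forall x, F (gen x) = f k x.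
  apply: raag_lift => x y xy; rewrite /f.
  case: (x =P a) (y =P a) xy => [->|_] [->|_] xy.
  - exact: commute_refl.
  - apply/commute_sym/commuteM; first exact/commute_sym/gen_commute.
    exact/commute_expgz/lkst.
  - apply/commuteM; first exact/gen_commute.
    by apply/commute_expgz/lkst; rewrite adj_sym.
  - exact: gen_commute.
have FV k x : F k (f (- k)%R x) = gen x.
  rewrite {1}/f; case: (x =P a) => [->|/eqP xa]; last by rewrite FE /f (negPf xa).
  rewrite gmulfM gmulf_expgz !FE /f eqxx [b == a]eq_sym (negPf ab) -mulgA -expgzD.
  by rewrite GRing.addrN mulg1.
have /choice[tau tauE] (n : nat) : exists tau : Aut G, forall x, tau x = F n x.
  apply: (@raag_aut (f n) (f (- n%:Z)%R) (F n) (F (- n%:Z)%R)) => x //.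
  by rewrite -[X in f X x](GRing.opprK (Posz n)).
have [m [n [g [mn /(_ (gen a))]]]] := finite_Out_inner tau fin.
have [|X XE] := @raag_lift V E Z (fun x => Posz (x == b)).
  by move=> x y _; apply: GRing.addrC.
have XJ x : X (x ^ g) = X x.
  by rewrite gmulfJ; apply/commute_conjg; apply: GRing.addrC.
rewrite !tauE !FE /f eqxx => /(congr1 X); rewrite XJ !gmulfM !gmulf_expgz !XE.
rewrite (negPf ab) eqxx => /mulgI; rewrite !expgz_int => -[nm].
by rewrite nm ltnn in mn.
Qed.

(** Otherwise conjugating the generators in [U] by [b^k] gives automorphisms. If those for [m] and
    [n] differ by conjugation by [g], then both [g] and [g b^(m-n)] have coordinate 0 at [gen b], so
    [m = n]. *)
Lemma finite_Out_no_separating_star : finite_Out G -> no_separating_star E.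
Proof.
move=> fin b W WP x0 y0 nx0 ny0 Wx0; apply: contrapT => nWy0.
pose U x := `[< W x /\ ~ commute (gen x) (gen b) >].
have UE x y : E x y -> U x -> ~~ U y -> commute (gen y) (gen b).
  move=> xy /asboolP[Wx nx] /asboolP nU; apply: contrapT => ny; apply: nU; split=> //.
  exact: WP xy Wx.
pose f k x := if U x then gen x ^ expgz (gen b) k else gen x.
have /choice[F FE] (k : int) :
    exists F : UMagmaMorphism.type G G, forall x, F (gen x) = f k x.
  have half x y : E x y -> U x -> ~~ U y -> commute (gen x ^ expgz (gen b) k) (gen y).
    move=> xy Ux /(UE _ _ xy Ux)/(commute_expgz k)/commute_conjg <-.
    exact/commuteJ/gen_commute.
  apply: raag_lift => x y xy; have yx := xy; rewrite adj_sym in yx; rewrite /f.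
  case: ifPn => Ux; case: ifPn => Uy.
  - exact/commuteJ/gen_commute.
  - exact: half.
  - exact/commute_sym/half.
  - exact: gen_commute.
have Ub : U b = false by apply/asboolP => -[_]; apply.
have FV k x : F k (f (- k)%R x) = gen x.
  rewrite {1}/f; case: ifPn => Ux; last by rewrite FE /f (negPf Ux).
  rewrite gmulfJ gmulf_expgz !FE /f Ux Ub -conjgM -expgzD.
  by rewrite GRing.addrN conjg1.
have /choice[tau tauE] (n : nat) : exists tau : Aut G, forall x, tau x = F n x.
  apply: (@raag_aut (f n) (f (- n%:Z)%R) (F n) (F (- n%:Z)%R)) => x //.
  by rewrite -[X in f X x](GRing.opprK (Posz n)).
have [m [n [g [mn gE]]]] := finite_Out_inner tau fin.
have gb : gen b ^ g = gen b by have := gE (gen b); rewrite !tauE !FE /f Ub.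
have Ux0 : U x0 by apply/asboolP.
have Uy0 : U y0 = false by apply/asboolP => -[].
(* As [g] fixes [gen y0], both [1] and [g] lie on the carrier of [gen y0], which does not commute
   with [gen b]. *)
have cy : cross (gen b) 1 = cross (gen b) g.
  apply: (@cross_carrier V E (gen y0)) => //; first by exists y0; rewrite conjg1.
  by exists y0; have := gE (gen y0); rewrite !tauE !FE /f Uy0.
pose h := g * expgz (gen b) (m%:Z - n%:Z)%R.
have cx : cross (gen b) 1 = cross (gen b) h.
  apply: (@cross_carrier V E (gen x0)) => //; first by exists x0; rewrite conjg1.
  exists x0; have := gE (gen x0); rewrite !tauE !FE /f Ux0 -conjgM => e.
  have -> : h = expgz (gen b) m * g * expgz (gen b) (- n%:Z)%R.
    rewrite /h expgzD mulgA; congr (_ * _); apply: commute_expgz.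
    exact/commute_sym/commute_conjg.
  by rewrite conjgM -e -conjgM -expgzD GRing.addrN conjg1.
move: cx; rewrite /h crossM_expgz gb eqxx -cy cross1; lia.
Qed.

(** The star of a central vertex contains every link, so by [no_transvection] it is the only vertex
    and [G] is infinite cyclic. *)
Lemma not_int_no_central_vertex :
  no_transvection E -> ~ isomorphic G Z -> no_central_vertex E.
Proof.
move=> noT niso b; apply: contrapT => cb; apply: niso.
have bE a : a = b.
  apply: contrapT => /noT[x _ nxb]; apply: cb; by exists x.
have [|F FE] := @raag_lift V E Z (fun=> 1%R).
  by move=> x y _; apply: GRing.addrC.
exists F; exists (expgz (gen b)) => [g|k]; last by rewrite gmulf_expgz FE expgz_int.
elim/raag_ind: g => [|a k g IHg]; first by rewrite gmulf1.
by rewrite gmulfM expgzD IHg gmulf_expgz FE expgz_int [a]bE.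
Qed.

End FiniteOut.

(** * The isomorphism *)

Section Assembly.
Variables (V : finType) (E : sgraph V).
Local Notation G := (raag E).
Local Notation gen := (raag_gen E).
Local Notation dist := (@syllable_dist V E).
Local Notation H := (ext_vertex E).
Local Notation K := (extension_complex E).

Lemma ext_adjE (u v : H) : extension_graph E u v = (u != v) && cstar u v.
Proof.
rewrite cstarC /= /ext_adj; congr (_ && _).
by apply/eqP/cstarP.
Qed.

Lemma extension_complex2 (u v : H) : u <> v -> K [fset u; v]%fset <-> cstar u v.
Proof.
move=> /eqP uv; split=> [[_ /(_ u v (fset21 _ _) (fset22 _ _) uv)]|cuv].
  by rewrite ext_adjE => /andP[].
split; first by apply/fset0Pn; exists u; rewrite fset21.
move=> x y /fset2P[]-> /fset2P[]->; rewrite ?eqxx // => xy.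
  by rewrite ext_adjE xy.
by rewrite ext_adjE xy cstarC.
Qed.

Lemma simplicial_autE (f : Sym H) :
  simplicial_aut K f <-> forall u v, cstar (f u) (f v) = cstar u v.
Proof.
have fI : injective f := can_inj (sym_funK f).
split=> [/asboolP fK u v|fC].
  case: (pselect (u = v)) => [->|uv]; first by apply/cstarP/cstarP.
  have fuv : f u <> f v by move/fI.
  have := fK [fset u; v]%fset.
  have -> : [fset f x | x in [fset u; v]]%fset = [fset f u; f v]%fset.
    by rewrite imfsetU !imfset_fset1.
  move=> h; apply/idP/idP.
    by move=> /(extension_complex2 fuv)/h/(extension_complex2 uv).
  by move=> /(extension_complex2 uv)/h/(extension_complex2 fuv).
have adjE u v : extension_graph E (f u) (f v) = extension_graph E u v.
  by rewrite !ext_adjE fC (inj_eq fI).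
apply/asboolP => s; split=> -[s0 sE]; split.
- by apply: contra s0 => /eqP->; rewrite imfset0.
- move=> x y xs ys xy; rewrite -adjE.
  by apply: sE; rewrite ?mem_imfset // (inj_eq fI).
- by have /fset0Pn[x xs] := s0; apply/fset0Pn; exists (f x); rewrite mem_imfset.
- move=> _ _ /imfsetP[x xs ->] /imfsetP[y ys ->]; rewrite (inj_eq fI) adjE.
  exact: sE.
Qed.

Lemma corresponds_comp (f g : H -> H) p q r :
  corresponds f p q -> corresponds g q r -> corresponds (g \o f) p r.
Proof. by move=> pq qr w; apply: (iff_trans (pq w)); apply: qr. Qed.

Lemma corresponds_eq (f g : H -> H) p q :
  f =1 g -> corresponds f p q -> corresponds g p q.
Proof. by move=> fg pq w; rewrite -fg; apply: pq. Qed.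

(** Lets walls be recovered from points. If the labels [a] and [b] at [p] differed, a generator
    adjacent to [a] but not commuting with [b] would lead along the carrier of [u] and off that of
    [v]. *)
Lemma eq_carrier (u v : H) : no_transvection E ->
  (forall p, carrier (u : G) p -> carrier (v : G) p) -> u = v.
Proof.
move=> noT uv; have [p up] := ext_vertex_carrier u; have vp := uv _ up.
have [a ua] := up; have [b vb] := vp; case: (a =P b) => [ab|/noT[x ax]].
  by apply/val_inj/(@conjg_inj G p); rewrite [LHS]ua [RHS]vb ab.
case; have /uv[c] : carrier (u : G) (p * gen x).
  exists a; rewrite conjgM ua; apply/commute_conjg.
  exact: gen_commute.
rewrite conjgM vb => bc; apply/commute_sym/commute_conjg.
by rewrite bc -(gen_conj_inj bc).
Qed.

Hypothesis noT : no_transvection E.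
Hypothesis noS : no_separating_star E.
Hypothesis noC : no_central_vertex E.

Lemma AutC_isometry (f : AutC K) :
  exists phi : Isom dist, forall p, corresponds f p (phi p).
Proof.
have fC := proj1 (simplicial_autE f) (autCP f).
have gC u v : cstar (SymV f u) (SymV f v) = cstar u v.
  by rewrite -fC /= !sym_invK.
have [/choice[phi phiP] /choice[psi psiP]] :=
  (corresponds_ex noT noS noC fC, corresponds_ex noT noS noC gC).
have id_inj p q (h : H -> H) : h =1 id -> corresponds h p q -> q = p.
  move=> hid pq; apply: (corresponds_inj noC (f := id) _ _ (fun=> iff_refl _)).
    by move=> v; exists v.
  exact: corresponds_eq pq.
have phiK : cancel phi psi.
  move=> p; apply: id_inj (corresponds_comp (phiP p) (psiP _)).
  exact: sym_funK.
have psiK : cancel psi phi.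
  move=> p; apply: id_inj (corresponds_comp (psiP p) (phiP _)).
  exact: sym_invK.
have I : isometric dist (MkSym phiK psiK).
  by apply/asboolP => x y; apply: (corresponds_dist noT noS noC fC).
by exists (MkIsom I).
Qed.

Lemma Isom_simplicial (phi : Isom dist) :
  exists f : AutC K, forall p, corresponds f p (phi p).
Proof.
have [f [fC fP]] := isometry_wall_map (elimT (asboolP _) (isomP phi)).
by have fK := proj2 (simplicial_autE f) fC; exists (MkAutC fK).
Qed.

Lemma AutC_Isom_isomorphic : isomorphic (AutC K) (Isom dist).
Proof.
have /choice[Phi PhiP] := AutC_isometry; have /choice[Psi PsiP] := Isom_simplicial.
have surj (f : AutC K) v : exists w, v = f w.
  by exists (sym_inv f v); rewrite sym_invK.
have PhiM : {morph Phi : f g / f * g}.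
  move=> f g; apply/val_inj/SymP => p.
  apply: (corresponds_inj noC (surj (f * g)) (PhiP (f * g) p)).
  exact: (corresponds_comp (PhiP g p) (PhiP f (Phi g p))).
exists (HB.pack_for {multiplicative AutC K -> Isom dist} Phi
          (isMultiplicative.Build _ _ Phi PhiM)).
exists Psi => [f|phi]; apply/val_inj/SymP => x /=.
  apply: (eq_carrier noT) => q; rewrite -[q](sym_invK (Phi f)).
  by move=> /(PsiP (Phi f) _ x)/(PhiP f _ x).
exact: (corresponds_inj noC (surj (Psi phi)) (PhiP (Psi phi) x) (PsiP phi x)).
Qed.

End Assembly.

Theorem theorem1p9 (V : finType) (Gamma : sgraph V) :
  finite_Out (raag Gamma) ->
  ~ isomorphic (raag Gamma) (Algebra.to_multiplicative int) ->
  isomorphic (AutC (extension_complex Gamma)) (Isom (@syllable_dist V Gamma)).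
Proof.
move=> fin niso; have noT := finite_Out_no_transvection fin.
apply: AutC_Isom_isomorphic => //; first exact: finite_Out_no_separating_star.
exact: not_int_no_central_vertex.
Qed.
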